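(* Let $(\mathbb{S}^2,g)$ be the standard two sphere, let $X$ be a conformal Killing vector field on $(\mathbb{S}^2,g)$, and let $g_u=e^ug$ be a conformal metric to $g$ on $\mathbb{S}^2$, where $u$ is a smooth function on $\mathbb{S}^2$. Then $$\int_{\mathbb{S}^2} X\big(\sigma_2(g_u^{-1}A_{g_u})\big)\,e^u\, dV_g=0.$$
   Context: $(\mathbb{S}^2,g)$ is the standard round two sphere, with Gaussian curvature $K_g\equiv 1$, and $dV_g$ is its volume form. For $g_u=e^ug$, $$A_{g_u}:=-\nabla_{g}^2u+\tfrac{1}{2}du\otimes du-\tfrac{1}{4}|\nabla_{g} u|^2g+K_{g} g,$$ and $\sigma_2(g_u^{-1}A_{g_u})$ denotes the product of the two eigenvalues of $g_u^{-1}A_{g_u}$. For a function $h$, $X(h)$ denotes the derivative of $h$ in the direction $X$. *)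

(* Defs.v *)
From Stdlib Require Import Reals Lra.
From Coquelicot Require Import Coquelicot.
Open Scope R_scope.

(** The standard round sphere is realised as the unit sphere of R^3 with the
    induced metric. *)

Notation R3 := (R * R * R)%type.

Definition vec (a b c : R) : R3 := (a, b, c).
Definition cx (v : R3) : R := fst (fst v).
Definition cy (v : R3) : R := snd (fst v).
Definition cz (v : R3) : R := snd v.

Definition dot (v w : R3) : R := cx v * cx w + cy v * cy w + cz v * cz w.

Record S2 : Type := mkS2 { pt : R3; pt_unit : dot pt pt = 1 }.

Lemma sph_unit (th ph : R) :
  let v := vec (sin th * cos ph) (sin th * sin ph) (cos th) in dot v v = 1.
Proof.
unfold dot, vec, cx, cy, cz; simpl.
generalize (sin2_cos2 th) (sin2_cos2 ph); unfold Rsqr; intros Ht Hp.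
transitivity (sin th * sin th * (sin ph * sin ph + cos ph * cos ph)
              + cos th * cos th).
ring. rewrite Hp; lra.
Qed.

(** Spherical coordinates: colatitude [th], longitude [ph]. *)
Definition sph (th ph : R) : S2 := mkS2 _ (sph_unit th ph).

Lemma dot_self_ge0 (x : R3) : 0 <= dot x x.
Proof.
unfold dot.
generalize (Rle_0_sqr (cx x)) (Rle_0_sqr (cy x)) (Rle_0_sqr (cz x)).
unfold Rsqr; lra.
Qed.

Lemma normalized_unit (x : R3) :
  dot x x <> 0 ->
  let v := vec (cx x / sqrt (dot x x)) (cy x / sqrt (dot x x))
               (cz x / sqrt (dot x x)) in dot v v = 1.
Proof.
intros Hx v.
assert (Hs : sqrt (dot x x) <> 0).
{ intros E; apply Hx. apply sqrt_eq_0; [apply dot_self_ge0 | exact E]. }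
assert (Hq := sqrt_sqrt _ (dot_self_ge0 x)).
unfold v; set (r := sqrt (dot x x)) in *.
transitivity (dot x x / (r * r)).
unfold dot, vec, cx, cy, cz; simpl; field; exact Hs.
rewrite Hq; field; exact Hx.
Qed.

(** Radial projection [x |-> x / |x|]; the value at the origin is junk. *)
Definition rproj (x : R3) : S2 :=
  match Req_EM_T (dot x x) 0 with
  | left _ => sph 0 0
  | right Hx => mkS2 _ (normalized_unit x Hx)
  end.

(** Since [rproj] is a smooth submersion of the punctured space onto the sphere,
    [f] is smooth on the sphere iff [fun x => f (rproj x)] is smooth away from
    the origin. *)

Definition line (x v : R3) (t : R) : R3 := plus x (scal t v).

Fixpoint Ck_punctured (k : nat) (F : R3 -> R) : Prop :=
  (forall x : R3, x <> zero -> continuous F x) /\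
  match k with
  | O => True
  | S k' => forall v : R3,
      (forall x : R3, x <> zero -> ex_derive (fun t => F (line x v t)) 0) /\
      Ck_punctured k' (fun x => Derive (fun t => F (line x v t)) 0)
  end.

Definition smooth (f : S2 -> R) : Prop :=
  forall k, Ck_punctured k (fun x => f (rproj x)).

Definition tangent (p : S2) (v : R3) : Prop := dot (pt p) v = 0.

Definition tproj (p : S2) (v : R3) : R3 :=
  plus v (scal (- dot (pt p) v) (pt p)).

(** For tangent [v], the curve [t |-> rproj (p + t v)] on the sphere passes
    through [p] with velocity [v], so this is the differential of [f].  For
    arbitrary [v] it is the differential at the tangential part of [v]. *)
Definition dS (f : S2 -> R) (p : S2) (v : R3) : R :=
  Derive (fun t => f (rproj (line (pt p) v t))) 0.

Definition is_vector_field (X : S2 -> R3) : Prop :=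
  (forall p, tangent p (X p)) /\
  smooth (fun p => cx (X p)) /\ smooth (fun p => cy (X p)) /\
  smooth (fun p => cz (X p)).

(** The directional derivative [X(h)]. *)
Definition lieD (X : S2 -> R3) (h : S2 -> R) (p : S2) : R := dS h p (X p).

(** The tangent vector with [dot (grad u p) v = dS u p v]. *)
Definition grad (u : S2 -> R) (p : S2) : R3 :=
  vec (dS u p (vec 1 0 0)) (dS u p (vec 0 1 0)) (dS u p (vec 0 0 1)).

(** Levi-Civita connection of the induced metric: tangential part of the
    componentwise derivative of [Y] along [v]. *)
Definition nabla (v : R3) (Y : S2 -> R3) (p : S2) : R3 :=
  tproj p (vec (dS (fun q => cx (Y q)) p v)
               (dS (fun q => cy (Y q)) p v)
               (dS (fun q => cz (Y q)) p v)).

Definition hess (u : S2 -> R) (p : S2) (v w : R3) : R :=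
  dot (nabla v (grad u) p) w.

(** [L_X g = lam g], with [L_X g] written through the Levi-Civita connection;
    [lam] is automatically smooth, being the divergence of [X]. *)
Definition conformal_killing (X : S2 -> R3) : Prop :=
  is_vector_field X /\
  exists lam : S2 -> R, forall (p : S2) (v w : R3),
    tangent p v -> tangent p w ->
    dot (nabla v X p) w + dot v (nabla w X p) = lam p * dot v w.

Definition gauss_curv (p : S2) : R := 1.

Definition conf_metric (u : S2 -> R) (p : S2) (v w : R3) : R :=
  exp (u p) * dot v w.

Definition A_tensor (u : S2 -> R) (p : S2) (v w : R3) : R :=
  - hess u p v w + / 2 * (dS u p v * dS u p w)
  - / 4 * dot (grad u p) (grad u p) * dot v w + gauss_curv p * dot v w.

(** [g_u^{-1} A e = l e] as endomorphisms of the tangent plane at [p]. *)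
Definition eigenpair (u : S2 -> R) (p : S2) (l : R) (e : R3) : Prop :=
  tangent p e /\
  forall w, tangent p w -> A_tensor u p e w = l * conf_metric u p e w.

Definition lin_indep (e1 e2 : R3) : Prop :=
  forall a b : R, plus (scal a e1) (scal b e2) = zero -> a = 0 /\ b = 0.

(** The product of the two eigenvalues, counted with multiplicity by means of a
    basis of eigenvectors.  [A_tensor] is symmetric for smooth [u], so such a
    basis exists and the product is unique. *)
Definition sigma2 (u : S2 -> R) (p : S2) : R :=
  iota (fun s : R => exists (l1 l2 : R) (e1 e2 : R3),
    lin_indep e1 e2 /\ eigenpair u p l1 e1 /\ eigenpair u p l2 e2 /\
    s = l1 * l2).

(** Integration against the volume form [sin th dth dph]. *)
Definition sphere_int (f : S2 -> R) : R :=
  RInt (fun th => RInt (fun ph => f (sph th ph) * sin th) 0 (2 * PI)) 0 PI.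

(* Main.v *)
Require Import Defs.
From Stdlib Require Import Reals Lra Psatz FunctionalExtensionality ProofIrrelevance.
From Coquelicot Require Import Coquelicot.
Open Scope R_scope.

(** Put [v = div X + X(u)], so that [L_X g_u = v g_u]. The tensor [A] is natural under
    the conformal maps of the round sphere, so [L_X A] is the variation of [A] along
    [g_u -> (1 + t v) g_u], which is minus the [g_u]-Hessian of [v]. The Newton tensor [T]
    (the cofactor tensor of [A]) is divergence free for [g_u], hence
    [X(sigma_2) = - div_u (T grad v) - 2 v sigma_2]. As [div_u X = v], the last term is
    [- 2 div_u (sigma_2 X) + 2 X(sigma_2)], and therefore
    [X(sigma_2) = div_u (T grad v + 2 sigma_2 X)]: the integrand is a divergence.

    Naturality of [A] under [X] is the only place where [X] has to be a global field. It
    amounts to [Hess l + l g = 0] for [l = div X], which fails for a general local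
    conformal field. For a global one, [l] satisfies [Lap l = - 2 l], and Bochner's formula
    then makes [|Hess l + l g|^2] equal to the Laplacian of [(|grad l|^2 + l^2) / 2]; its
    integral vanishes, so it is zero ([bochner], [conformal_divergence_hessian]).

    The computations use two conformal fields, the meridian field [mer] (minus the
    gradient of the height) and the rotation [rot]. They are the
    coordinate fields of the Mercator projection: they commute ([D_comm]), are orthogonal,
    and both have squared length [sinsq], the squared sine of the colatitude. Consequently
    they act on smooth functions on the sphere as commuting derivations [D1], [D2], with
    [D1 pz = - sinsq] and [D2 pz = 0], and each tensor identity becomes a polynomial
    identity between iterated derivatives, with powers of [sinsq] as the only
    denominators. The degeneration of the frame at the poles is harmless: two smooth
    functions that agree elsewhere are equal ([smooth_eq]), and in the divergence theorem
    ([sphere_int_divergence]) it suffices that the inner product of the field with [mer]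
    is smooth and vanishes at the poles. Accordingly [flux1] is written with gradients,
    Laplacians and ambient derivatives only, without dividing by [sinsq]. *)

(** * Differentiable functions on the punctured space *)

Definition e_x : R3 := vec 1 0 0.
Definition e_y : R3 := vec 0 1 0.
Definition e_z : R3 := vec 0 0 1.

Definition dir (v : R3) (F : R3 -> R) (x : R3) : R :=
  Derive (fun t => F (line x v t)) 0.

Lemma vec_eta (x : R3) : x = vec (cx x) (cy x) (cz x).
Proof. now destruct x as [[a b] c]. Qed.

Lemma R3_ext (x y : R3) : cx x = cx y -> cy x = cy y -> cz x = cz y -> x = y.
Proof. intros H1 H2 H3; now rewrite (vec_eta x), (vec_eta y), H1, H2, H3. Qed.

Lemma line_vec x v t :
  line x v t = vec (cx x + t * cx v) (cy x + t * cy v) (cz x + t * cz v).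
Proof. now destruct x as [[a b] c], v as [[a' b'] c']. Qed.

Lemma line_line x v s t : line (line x v s) v t = line x v (s + t).
Proof. rewrite !line_vec; apply R3_ext; cbn; ring. Qed.

Lemma line_0 x v : line x v 0 = x.
Proof. rewrite line_vec; apply R3_ext; cbn; ring. Qed.

Lemma dot_zero_iff x : dot x x = 0 <-> x = zero.
Proof.
split.
- intros H; unfold dot in H. apply R3_ext; cbn; nra.
- intros ->; unfold dot; cbn; ring.
Qed.

Lemma dot_pos x : x <> zero -> 0 < dot x x.
Proof.
intros Hx; destruct (dot_self_ge0 x) as [H|H]; [easy|].
now symmetry in H; apply dot_zero_iff in H.
Qed.

Lemma continuous_cx x : continuous cx x.
Proof.
apply (continuous_comp (fst : R3 -> R * R) fst).
apply continuous_fst. apply continuous_fst.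
Qed.
Lemma continuous_cy x : continuous cy x.
Proof.
apply (continuous_comp (fst : R3 -> R * R) snd).
apply continuous_fst. apply continuous_snd.
Qed.
Lemma continuous_cz x : continuous cz x.
Proof. apply continuous_snd. Qed.

Lemma continuous_vec {U : UniformSpace} (f g h : U -> R) (u : U) :
  continuous f u -> continuous g u -> continuous h u ->
  continuous (fun w => vec (f w) (g w) (h w)) u.
Proof.
intros Hf Hg Hh.
apply (continuous_comp_2 (fun w => (f w, g w)) h (fun a b => (a, b) : R3)); trivial.
- apply (continuous_comp_2 f g (fun a b => (a, b))); trivial.
  apply continuous_ext with (fun x => x); [now intros []|apply continuous_id].
- apply continuous_ext with (fun x => x); [now intros []|apply continuous_id].
Qed.

Lemma continuous_dot (x : R3) : continuous (fun y => dot y y) x.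
Proof.
apply (continuous_plus (V := R_NormedModule)
         (fun y : R3 => cx y * cx y + cy y * cy y) (fun y => cz y * cz y)).
apply (continuous_plus (V := R_NormedModule)
         (fun y : R3 => cx y * cx y) (fun y => cy y * cy y)).
- apply (continuous_mult (K := R_AbsRing) cx cx); apply continuous_cx.
- apply (continuous_mult (K := R_AbsRing) cy cy); apply continuous_cy.
- apply (continuous_mult (K := R_AbsRing) cz cz); apply continuous_cz.
Qed.

Lemma locally_nonzero (x : R3) : x <> zero -> locally x (fun y => y <> zero).
Proof.
intros Hx.
assert (H := continuous_dot x (fun r => 0 < r)).
destruct H as [d Hd].
{ apply (open_gt 0); now apply dot_pos. }
exists d; intros y Hy E. specialize (Hd y Hy). cbn in Hd.
apply (proj2 (dot_zero_iff y)) in E. lra.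
Qed.

Lemma is_derive_line F x v t :
  ex_derive (fun s => F (line (line x v t) v s)) 0 ->
  is_derive (fun s => F (line x v s)) t (dir v F (line x v t)).
Proof.
intros Hd.
generalize (Derive_correct _ _ Hd); fold (dir v F (line x v t)); intros H.
apply is_derive_ext with (fun s => F (line (line x v t) v (s - t))).
{ intros s; rewrite line_line; do 2 f_equal; ring. }
replace (dir v F (line x v t)) with (scal 1 (dir v F (line x v t))) by apply Rmult_1_l.
apply (is_derive_comp (K := R_AbsRing) (V := R_NormedModule)
         (fun s => F (line (line x v t) v s)) (fun s => s - t)).
- now replace (t - t) with 0 by ring.
- auto_derive; trivial; ring.
Qed.

Lemma mvt_dir F x v (h M e : R) :
  (forall t, Rmin 0 h <= t <= Rmax 0 h ->
     ex_derive (fun s => F (line (line x v t) v s)) 0) ->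
  (forall t, Rmin 0 h <= t <= Rmax 0 h -> Rabs (dir v F (line x v t) - M) <= e) ->
  Rabs (F (line x v h) - F x - M * h) <= e * Rabs h.
Proof.
intros Hd Hb.
destruct (MVT_gen (fun s => F (line x v s)) 0 h (fun t => dir v F (line x v t)))
  as [c [Hc E]].
- intros t Ht; apply is_derive_line, Hd; lra.
- intros t Ht.
  apply continuity_pt_filterlim, (ex_derive_continuous (V := R_NormedModule)).
  eexists; apply is_derive_line, Hd; lra.
- rewrite line_0 in E. rewrite E.
  replace (_ - M * h) with ((dir v F (line x v c) - M) * h) by ring.
  rewrite Rabs_mult. apply Rmult_le_compat_r; [apply Rabs_pos|now apply Hb].
Qed.

Lemma ball_R3 (x y : R3) (d : R) :
  ball x d y <-> Rabs (cx y - cx x) < d /\ Rabs (cy y - cy x) < d /\ Rabs (cz y - cz x) < d.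
Proof.
destruct x as [[a b] c], y as [[a' b'] c']. cbn.
unfold ball; cbn; unfold prod_ball; cbn; unfold prod_ball; cbn.
unfold AbsRing_ball, abs, minus, plus, opp; cbn. unfold Rminus; tauto.
Qed.

Lemma between_abs a h t : Rmin 0 h <= t <= Rmax 0 h -> Rabs h < a -> Rabs t < a.
Proof.
unfold Rmin, Rmax; destruct (Rle_dec 0 h); intros Ht Ha;
apply Rabs_def2 in Ha; apply Rabs_def1; lra.
Qed.

(** A function with continuous partial derivatives is differentiable: the
    increment is split into three increments parallel to the axes, each controlled
    by the mean value theorem. *)
Lemma C1_increment F x (e : posreal) :
  (locally x (fun y => forall v, ex_derive (fun t => F (line y v t)) 0)) ->
  (forall v, continuous (dir v F) x) ->
  locally x (fun y =>
    Rabs (F y - F x - ((cx y - cx x) * dir e_x F x + (cy y - cy x) * dir e_y F x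
                       + (cz y - cz x) * dir e_z F x))
    <= e * (Rabs (cx y - cx x) + Rabs (cy y - cy x) + Rabs (cz y - cz x))).
Proof.
intros Hd Hc.
assert (Hb : forall v, locally x (fun y => Rabs (dir v F y - dir v F x) < e)).
{ intros v. exact (Hc v (fun r => Rabs (r - dir v F x) < e) (locally_ball _ e)). }
assert (H := filter_and _ _ Hd (filter_and _ _ (Hb e_x) (filter_and _ _ (Hb e_y) (Hb e_z)))).
clear Hb Hd; destruct H as [d H]; exists d; intros y Hy.
apply ball_R3 in Hy; destruct Hy as (H1 & H2 & H3).
set (h1 := cx y - cx x) in *; set (h2 := cy y - cy x) in *; set (h3 := cz y - cz x) in *.
set (x2 := line x e_x h1); set (x3 := line x2 e_y h2).
assert (E : y = line x3 e_z h3).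
{ unfold x3, x2, h1, h2, h3; rewrite !line_vec; apply R3_ext; cbn; ring. }
assert (z0 := cond_pos d).
assert (A1 : Rabs (F x2 - F x - dir e_x F x * h1) <= e * Rabs h1).
{ apply mvt_dir; intros t Ht; assert (Ht' := between_abs _ _ _ Ht H1).
  all: destruct (H (line x e_x t)) as (K0 & K1 & K2 & K3);
    [rewrite line_vec; apply ball_R3; cbn; repeat split|];
    [..|now auto with real];
    match goal with |- Rabs ?a < _ =>
      first [replace a with t by ring | replace a with 0 by ring; rewrite Rabs_R0] end;
    trivial. }
assert (A2 : Rabs (F x3 - F x2 - dir e_y F x * h2) <= e * Rabs h2).
{ apply mvt_dir; intros t Ht; assert (Ht' := between_abs _ _ _ Ht H2).
  all: destruct (H (line x2 e_y t)) as (K0 & K1 & K2 & K3);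
    [unfold x2; rewrite !line_vec; apply ball_R3; cbn; repeat split|];
    [..|now auto with real];
    match goal with |- Rabs ?a < _ =>
      first [replace a with h1 by ring | replace a with t by ring
            | replace a with 0 by ring; rewrite Rabs_R0] end;
    trivial. }
assert (A3 : Rabs (F y - F x3 - dir e_z F x * h3) <= e * Rabs h3).
{ rewrite E. apply mvt_dir; intros t Ht; assert (Ht' := between_abs _ _ _ Ht H3).
  all: destruct (H (line x3 e_z t)) as (K0 & K1 & K2 & K3);
    [unfold x3, x2; rewrite !line_vec; apply ball_R3; cbn; repeat split|];
    [..|now auto with real];
    match goal with |- Rabs ?a < _ =>
      first [replace a with h1 by ring | replace a with h2 by ring | replace a with t by ring] end;
    trivial. }
replace (F y - F x - _) with
  ((F x2 - F x - dir e_x F x * h1) + (F x3 - F x2 - dir e_y F x * h2)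
   + (F y - F x3 - dir e_z F x * h3)) by ring.
eapply Rle_trans; [apply Rabs_triang|].
eapply Rle_trans; [apply Rplus_le_compat_r, Rabs_triang|]. lra.
Qed.

(** The error is at most that of the linearisation of [F], from [C1_increment], plus the
    errors of the linearised components of the curve. *)
Lemma is_derive_curve F (x y z : R -> R) (x' y' z' t : R) :
  let p := vec (x t) (y t) (z t) in
  (locally p (fun y => forall v, ex_derive (fun t => F (line y v t)) 0)) ->
  (forall v, continuous (dir v F) p) ->
  is_derive x t x' -> is_derive y t y' -> is_derive z t z' ->
  is_derive (fun s => F (vec (x s) (y s) (z s))) t
    (x' * dir e_x F p + y' * dir e_y F p + z' * dir e_z F p).
Proof.
intros p Hd Hc Hx Hy Hz.
split; [apply is_linear_scal_l|].
intros t' Ht'. apply (is_filter_lim_locally_unique (K := R_AbsRing) (V := R_NormedModule)) in Ht'. subst t'.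
intros eps.
set (m1 := dir e_x F p); set (m2 := dir e_y F p); set (m3 := dir e_z F p).
set (B := 1 + Rabs m1 + Rabs m2 + Rabs m3).
assert (P1 := Rabs_pos m1); assert (P2 := Rabs_pos m2); assert (P3 := Rabs_pos m3).
assert (Q1 := Rabs_pos x'); assert (Q2 := Rabs_pos y'); assert (Q3 := Rabs_pos z').
set (K := Rabs x' + Rabs y' + Rabs z' + 3).
set (e1 := Rmin 1 (eps / (2 * 3 * B))).
assert (He := cond_pos eps).
assert (He1 : 0 < e1).
{ apply Rmin_glb_lt; [lra|]. apply Rdiv_lt_0_compat; unfold B; lra. }
assert (He1' : e1 <= 1) by apply Rmin_l.
assert (He1'' : e1 * (3 * B) <= eps / 2).
{ apply Rle_trans with (eps / (2 * 3 * B) * (3 * B)).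
  apply Rmult_le_compat_r; [unfold B; lra|apply Rmin_r].
  right; field. unfold B; lra. }
assert (He2 : 0 < eps / (2 * K)) by (apply Rdiv_lt_0_compat; unfold K; lra).
assert (HC := C1_increment F p (mkposreal _ He2) Hd Hc).
assert (Hcont : continuous (fun s => vec (x s) (y s) (z s)) t).
{ apply continuous_vec; apply (ex_derive_continuous (V := R_NormedModule)); eexists; eassumption. }
specialize (Hcont _ HC); unfold filtermap in Hcont.
assert (Hx' := proj2 Hx t (fun P H => H) (mkposreal _ He1)).
assert (Hy' := proj2 Hy t (fun P H => H) (mkposreal _ He1)).
assert (Hz' := proj2 Hz t (fun P H => H) (mkposreal _ He1)).
generalize (filter_and _ _ Hcont (filter_and _ _ Hx' (filter_and _ _ Hy' Hz'))).
apply filter_imp; intros s (G0 & G1 & G2 & G3).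
cbn in G0 |- *. fold m1 m2 m3 in G0.
unfold norm, minus, plus, opp, scal in G1, G2, G3 |- *; cbn in G1, G2, G3 |- *.
unfold abs, mult in G1, G2, G3 |- *; cbn in G1, G2, G3 |- *.
fold p.
set (h := s + - t) in *; set (a := x s - x t) in *; set (b := y s - y t) in *; set (c := z s - z t) in *.
assert (Hh := Rabs_pos h).
assert (T : forall a a', Rabs (a + - (h * a')) <= e1 * Rabs h -> Rabs a <= (Rabs a' + 1) * Rabs h).
{ clear -Hh He1'. intros a a' H. replace a with ((a + - (h * a')) + h * a') by ring.
  eapply Rle_trans; [apply Rabs_triang|]. rewrite Rabs_mult.
  assert (e1 * Rabs h <= 1 * Rabs h) by (apply Rmult_le_compat_r; lra). lra. }
change (x s + - x t) with a in G1. change (y s + - y t) with b in G2. change (z s + - z t) with c in G3.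
assert (T1 := T _ _ G1); assert (T2 := T _ _ G2); assert (T3 := T _ _ G3).
set (f0 := F (vec (x s) (y s) (z s)) - F p - (a * m1 + b * m2 + c * m3)) in G0.
replace (F _ + - F p + - _) with
  (f0 + ((a + - (h * x')) * m1 + (b + - (h * y')) * m2 + (c + - (h * z')) * m3))
  by (unfold f0; ring).
eapply Rle_trans; [apply Rabs_triang|].
apply Rle_trans with (eps / 2 * Rabs h + eps / 2 * Rabs h); [|right; field].
apply Rplus_le_compat.
- eapply Rle_trans; [apply G0|].
  apply Rle_trans with (eps / (2 * K) * (K * Rabs h)).
  + apply Rmult_le_compat_l; [lra|]. unfold K; lra.
  + right; field; unfold K; lra.
- eapply Rle_trans; [apply Rabs_triang|].
  eapply Rle_trans; [apply Rplus_le_compat_r, Rabs_triang|].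
  rewrite !Rabs_mult.
  apply Rle_trans with (e1 * (3 * B) * Rabs h); [|now apply Rmult_le_compat_r].
  assert (U : forall q m, q <= e1 * Rabs h -> 0 <= m <= B -> q * m <= e1 * B * Rabs h).
  { intros q m Hq Hm. apply Rle_trans with (e1 * Rabs h * m).
    apply Rmult_le_compat_r; lra.
    replace (e1 * B * Rabs h) with (e1 * Rabs h * B) by ring.
    apply Rmult_le_compat_l; [|lra]. apply Rmult_le_pos; lra. }
  assert (U1 := U _ (Rabs m1) G1); assert (U2 := U _ (Rabs m2) G2); assert (U3 := U _ (Rabs m3) G3).
  unfold B in *; lra.
Qed.

(** * Differentiability classes on the punctured space *)

Lemma Ck_continuous k (F : R3 -> R) (x : R3) : Ck_punctured k F -> x <> zero -> continuous F x.
Proof. destruct k; intros [H _]; apply H. Qed.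

Lemma Ck_ex_derive k (F : R3 -> R) (x v : R3) :
  Ck_punctured (S k) F -> x <> zero -> ex_derive (fun t => F (line x v t)) 0.
Proof. intros [_ H] Hx; now apply (H v). Qed.

Lemma Ck_dir k F v : Ck_punctured (S k) F -> Ck_punctured k (dir v F).
Proof. intros [_ H]; apply (H v). Qed.

Lemma Ck_S k (F : R3 -> R) :
  (forall x, x <> zero -> continuous F x) ->
  (forall v x, x <> zero -> ex_derive (fun t => F (line x v t)) 0) ->
  (forall v, Ck_punctured k (dir v F)) -> Ck_punctured (S k) F.
Proof. intros H1 H2 H3; split; [easy|]; intros v; split; [apply H2|apply H3]. Qed.

Lemma Ck_weaken k (F : R3 -> R) : Ck_punctured (S k) F -> Ck_punctured k F.
Proof.
revert F; induction k; intros F H.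
- split; [exact (proj1 H)|exact I].
- apply Ck_S.
  + exact (proj1 H).
  + intros v x; now apply (Ck_ex_derive (S k)).
  + intros v; now apply IHk, Ck_dir.
Qed.

Lemma continuous_line x v (t : R) : continuous (line x v) t.
Proof.
apply continuous_ext with
  (fun t => vec (cx x + t * cx v) (cy x + t * cy v) (cz x + t * cz v)).
{ intros s; now rewrite line_vec. }
apply continuous_vec; apply (ex_derive_continuous (V := R_NormedModule)); now auto_derive.
Qed.

Lemma locally_line (P : R3 -> Prop) x v :
  locally x P -> locally 0 (fun t => P (line x v t)).
Proof.
intros H; apply (continuous_line x v 0 P). now rewrite line_0.
Qed.

Lemma locally_line_nonzero x v : x <> zero -> locally 0 (fun t => line x v t <> zero).
Proof. intros Hx; apply (locally_line (fun y => y <> zero)), locally_nonzero, Hx. Qed.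

Lemma dir_ext_loc F G x v : locally x (fun y => F y = G y) -> dir v F x = dir v G x.
Proof. intros H; apply Derive_ext_loc. now apply (locally_line (fun y => F y = G y)). Qed.

(** [Ck_punctured] ignores the value at the origin, because lines through a nonzero
    point stay away from the origin for small times. *)
Lemma Ck_ext k (F G : R3 -> R) :
  (forall x, x <> zero -> F x = G x) -> Ck_punctured k F -> Ck_punctured k G.
Proof.
revert F G; induction k; intros F G E H.
- split; [|easy]. intros x Hx. apply continuous_ext_loc with F.
  + generalize (locally_nonzero _ Hx); apply filter_imp, E.
  + now apply (Ck_continuous 0).
- apply Ck_S.
  + intros x Hx. apply continuous_ext_loc with F.
    * generalize (locally_nonzero _ Hx); apply filter_imp, E.
    * now apply (Ck_continuous (S k)).
  + intros v x Hx. apply ex_derive_ext_loc with (fun t => F (line x v t)).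
    * generalize (locally_line_nonzero x v Hx); apply filter_imp; intros t; apply E.
    * now apply (Ck_ex_derive k).
  + intros v; apply IHk with (dir v F); [|now apply Ck_dir].
    intros x Hx; apply dir_ext_loc.
    generalize (locally_nonzero _ Hx); apply filter_imp, E.
Qed.

Lemma Ck_const k c : Ck_punctured k (fun _ => c).
Proof.
revert c; induction k; intros c.
- split; [|easy]; intros; apply continuous_const.
- apply Ck_S.
  + intros; apply continuous_const.
  + intros; apply ex_derive_const.
  + intros v; apply Ck_ext with (fun _ => 0); [|apply IHk].
    intros; symmetry; unfold dir; apply Derive_const.
Qed.

Lemma Ck_plus k F G :
  Ck_punctured k F -> Ck_punctured k G -> Ck_punctured k (fun x => F x + G x).
Proof.
revert F G; induction k; intros F G HF HG.
- split; [|easy]; intros x Hx.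
  apply (continuous_plus (V := R_NormedModule)); now apply (Ck_continuous 0).
- apply Ck_S.
  + intros x Hx. apply (continuous_plus (V := R_NormedModule)); now apply (Ck_continuous (S k)).
  + intros v x Hx. apply (ex_derive_plus (V := R_NormedModule)); now apply (Ck_ex_derive k).
  + intros v; apply Ck_ext with (fun x => dir v F x + dir v G x).
    * intros x Hx; symmetry; unfold dir; apply Derive_plus; now apply (Ck_ex_derive k).
    * apply IHk; now apply Ck_dir.
Qed.

Lemma dir_mult k F G v x :
  Ck_punctured (S k) F -> Ck_punctured (S k) G -> x <> zero ->
  dir v (fun x => F x * G x) x = dir v F x * G x + F x * dir v G x.
Proof.
intros HF HG Hx. unfold dir. rewrite Derive_mult; [|now apply (Ck_ex_derive k)..].
now rewrite line_0.
Qed.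

Lemma Ck_mult k F G :
  Ck_punctured k F -> Ck_punctured k G -> Ck_punctured k (fun x => F x * G x).
Proof.
revert F G; induction k; intros F G HF HG.
- split; [|easy]; intros x Hx.
  apply (continuous_mult (K := R_AbsRing)); now apply (Ck_continuous 0).
- apply Ck_S.
  + intros x Hx. apply (continuous_mult (K := R_AbsRing)); now apply (Ck_continuous (S k)).
  + intros v x Hx. apply ex_derive_mult; now apply (Ck_ex_derive k).
  + intros v; apply Ck_ext with (fun x => dir v F x * G x + F x * dir v G x).
    * intros x Hx; symmetry; now apply (dir_mult k).
    * apply Ck_plus; apply IHk; auto using Ck_dir, Ck_weaken.
Qed.

Lemma is_derive_exp_comp (g : R -> R) t :
  ex_derive g t -> is_derive (fun s => exp (g s)) t (Derive g t * exp (g t)).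
Proof. intros H; auto_derive; [exact H|]. change (fun x => g x) with g; ring. Qed.

Lemma Ck_exp k F : Ck_punctured k F -> Ck_punctured k (fun x => exp (F x)).
Proof.
revert F; induction k; intros F HF.
- split; [|easy]; intros x Hx.
  apply (continuous_comp F exp); [now apply (Ck_continuous 0)|].
  apply (ex_derive_continuous (V := R_NormedModule)); now auto_derive.
- apply Ck_S.
  + intros x Hx. apply (continuous_comp F exp); [now apply (Ck_continuous (S k))|].
    apply (ex_derive_continuous (V := R_NormedModule)); now auto_derive.
  + intros v x Hx. eexists; apply (is_derive_exp_comp (fun t => F (line x v t))).
    now apply (Ck_ex_derive k).
  + intros v; apply Ck_ext with (fun x => dir v F x * exp (F x)).
    * intros x Hx; symmetry; unfold dir.
      replace (exp (F x)) with (exp (F (line x v 0))) by now rewrite line_0.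
      apply is_derive_unique, (is_derive_exp_comp (fun t => F (line x v t))).
      now apply (Ck_ex_derive k).
    * apply Ck_mult; [now apply Ck_dir|]. apply IHk; now apply Ck_weaken.
Qed.

Lemma Ck_affine k (F : R3 -> R) :
  (forall x, continuous F x) ->
  (forall v, exists d, forall x t, F (line x v t) = F x + t * d) -> Ck_punctured k F.
Proof.
intros HF Hd; destruct k; [now split|].
apply Ck_S; [easy|..]; intros v; destruct (Hd v) as [d E].
- intros x _; apply ex_derive_ext with (fun t => F x + t * d); [easy|now auto_derive].
- apply Ck_ext with (fun _ => d); [|apply Ck_const].
  intros x _; symmetry; unfold dir.
  rewrite (Derive_ext _ _ 0 (E x)). apply is_derive_unique; auto_derive; trivial; ring.
Qed.

Lemma Ck_cx k : Ck_punctured k cx.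
Proof.
apply Ck_affine; [apply continuous_cx|].
intros v; exists (cx v); intros; now rewrite line_vec.
Qed.
Lemma Ck_cy k : Ck_punctured k cy.
Proof.
apply Ck_affine; [apply continuous_cy|].
intros v; exists (cy v); intros; now rewrite line_vec.
Qed.
Lemma Ck_cz k : Ck_punctured k cz.
Proof.
apply Ck_affine; [apply continuous_cz|].
intros v; exists (cz v); intros; now rewrite line_vec.
Qed.

Lemma Ck_dot k : Ck_punctured k (fun x => dot x x).
Proof. unfold dot; repeat apply Ck_plus; apply Ck_mult; auto using Ck_cx, Ck_cy, Ck_cz. Qed.

(** The inverse of the Euclidean norm. *)
Definition rnorm (x : R3) : R := / sqrt (dot x x).

Lemma is_derive_rnorm x v : x <> zero ->
  is_derive (fun t => rnorm (line x v t)) 0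
    (- (cx x * cx v + cy x * cy v + cz x * cz v) * (rnorm x * rnorm x * rnorm x)).
Proof.
intros Hx; unfold rnorm, dot.
assert (H := dot_pos x Hx).
apply is_derive_ext with
  (fun t => / sqrt ((cx x + t * cx v) * (cx x + t * cx v)
     + (cy x + t * cy v) * (cy x + t * cy v) + (cz x + t * cz v) * (cz x + t * cz v))).
{ intros t; now rewrite line_vec. }
assert (E : (cx x + 0 * cx v) * (cx x + 0 * cx v) + (cy x + 0 * cy v) * (cy x + 0 * cy v)
   + (cz x + 0 * cz v) * (cz x + 0 * cz v) = dot x x) by (unfold dot; ring).
assert (Hs := sqrt_lt_R0 _ H).
auto_derive; rewrite E.
- repeat split; trivial; lra.
- change (cx x * cx x + cy x * cy x + cz x * cz x) with (dot x x).
  field; lra.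
Qed.

(** By induction: a derivative of [rnorm] is a linear form times [rnorm]^3. *)
Lemma Ck_rnorm k : Ck_punctured k rnorm.
Proof.
assert (Hc : forall x, x <> zero -> continuous rnorm x).
{ intros x Hx. apply (continuous_comp (fun x => dot x x) (fun r => / sqrt r)).
  apply continuous_dot.
  assert (H := sqrt_lt_R0 _ (dot_pos x Hx)); assert (H' := dot_pos x Hx).
  apply (ex_derive_continuous (V := R_NormedModule)); auto_derive; repeat split; lra. }
induction k; [now split|].
apply Ck_S; [easy|..].
- intros v x Hx; eexists; now apply is_derive_rnorm.
- intros v; apply Ck_ext with
    (fun x => (cx x * (- cx v) + cy x * (- cy v) + cz x * (- cz v))
              * (rnorm x * rnorm x * rnorm x)).
  + intros x Hx; symmetry; unfold dir; apply is_derive_unique.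
    replace (_ * _) with
     (- (cx x * cx v + cy x * cy v + cz x * cz v) * (rnorm x * rnorm x * rnorm x)) by ring.
    now apply is_derive_rnorm.
  + apply Ck_mult.
    * repeat apply Ck_plus; apply Ck_mult; auto using Ck_cx, Ck_cy, Ck_cz, Ck_const.
    * repeat apply Ck_mult; trivial.
Qed.

Definition line2 (x v w : R3) (a b : R) : R3 := line (line x v a) w b.

Lemma line2_sym x v w a b : line2 x v w a b = line2 x w v b a.
Proof. unfold line2; rewrite !line_vec; apply R3_ext; cbn; ring. Qed.

Lemma continuous_affine2 a b c (z : R * R) :
  continuous (fun z => a + fst z * b + snd z * c) z.
Proof.
apply (continuous_plus (V := R_NormedModule) (fun z : R * R => a + fst z * b)
         (fun z => snd z * c)).
- apply (continuous_plus (V := R_NormedModule) (fun _ => a) (fun z : R * R => fst z * b)).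
  + apply continuous_const.
  + apply (continuous_mult (K := R_AbsRing) fst (fun _ => b));
    [apply continuous_fst|apply continuous_const].
- apply (continuous_mult (K := R_AbsRing) snd (fun _ => c));
  [apply continuous_snd|apply continuous_const].
Qed.

Lemma continuous_line2 x v w (z : R * R) :
  continuous (fun z => line2 x v w (fst z) (snd z)) z.
Proof.
apply continuous_ext with
  (fun z => vec (cx x + fst z * cx v + snd z * cx w) (cy x + fst z * cy v + snd z * cy w)
                (cz x + fst z * cz v + snd z * cz w)).
{ intros s; unfold line2; now rewrite !line_vec. }
apply (continuous_vec (fun z : R * R => cx x + fst z * cx v + snd z * cx w)
         (fun z => cy x + fst z * cy v + snd z * cy w)
         (fun z => cz x + fst z * cz v + snd z * cz w)); apply continuous_affine2.
Qed.

(** Schwarz' theorem in the plane through [x] spanned by [v] and [w]. *)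
Lemma dir_comm F x v w :
  Ck_punctured 2 F -> x <> zero -> dir v (dir w F) x = dir w (dir v F) x.
Proof.
intros HF Hx.
set (f := fun a b => F (line2 x v w a b)).
assert (D2 : forall a b, line2 x v w a b <> zero ->
   is_derive (fun t => f a t) b (dir w F (line2 x v w a b))).
{ intros a b H; apply (is_derive_line F (line x v a) w b).
  now apply (Ck_ex_derive 1). }
assert (D1 : forall a b, line2 x v w a b <> zero ->
   is_derive (fun t => f t b) a (dir v F (line2 x v w a b))).
{ intros a b H. rewrite line2_sym in H |- *.
  apply is_derive_ext with (fun t => F (line (line x w b) v t)).
  { intros t; unfold f; now rewrite line2_sym. }
  apply (is_derive_line F (line x w b) v a).
  now apply (Ck_ex_derive 1). }
assert (N : forall a b, line2 x v w a b <> zero ->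
   locally_2d (fun a b => line2 x v w a b <> zero) a b).
{ intros a b H. apply locally_2d_locally,  (continuous_line2 x v w (a, b) (fun y => y <> zero)).
  now apply locally_nonzero. }
assert (D12 : forall a b, line2 x v w a b <> zero ->
   is_derive (fun z => Derive (fun t => f z t) b) a (dir v (dir w F) (line2 x v w a b))).
{ intros a b H. apply is_derive_ext_loc with (fun z => dir w F (line2 x v w z b)).
  { assert (L := N a b H).
    apply locally_2d_1d_const_y in L. revert L; apply filter_imp; intros z Hz.
    symmetry; now apply is_derive_unique, D2. }
  rewrite line2_sym. apply is_derive_ext with (fun t => dir w F (line (line x w b) v t)).
  { intros t; now rewrite line2_sym. }
  apply (is_derive_line (dir w F) (line x w b) v a).
  rewrite line2_sym in H.
  apply (Ck_ex_derive 0); trivial. now apply Ck_dir. }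
assert (D21 : forall a b, line2 x v w a b <> zero ->
   is_derive (fun z => Derive (fun t => f t z) a) b (dir w (dir v F) (line2 x v w a b))).
{ intros a b H. apply is_derive_ext_loc with (fun z => dir v F (line2 x v w a z)).
  { assert (L := N a b H).
    apply locally_2d_1d_const_x in L. revert L; apply filter_imp; intros z Hz.
    symmetry; now apply is_derive_unique, D1. }
  apply (is_derive_line (dir v F) (line x v a) w b).
  apply (Ck_ex_derive 0); trivial. now apply Ck_dir. }
assert (E0 : line2 x v w 0 0 = x) by (unfold line2; now rewrite !line_0).
assert (Hx0 : line2 x v w 0 0 <> zero) by now rewrite E0.
assert (L0 : locally_2d (fun a b => line2 x v w a b <> zero) 0 0).
{ exact (N 0 0 Hx0). }
assert (C : forall G, Ck_punctured 0 G -> continuity_2d_pt (fun a b => G (line2 x v w a b)) 0 0).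
{ intros G HG. apply continuity_2d_pt_filterlim.
  apply (continuous_comp (fun z : R * R => line2 x v w (fst z) (snd z)) G (0, 0)).
  apply continuous_line2. now apply (Ck_continuous 0). }
assert (S1 := is_derive_unique _ _ _ (D12 0 0 Hx0)).
assert (S2 := is_derive_unique _ _ _ (D21 0 0 Hx0)).
rewrite E0 in S1, S2.
transitivity (Derive (fun z => Derive (fun t => f z t) 0) 0); [symmetry; exact S1|].
transitivity (Derive (fun z => Derive (fun t => f t z) 0) 0); [|exact S2].
apply Schwarz.
- revert L0; apply locally_2d_impl, locally_2d_forall; intros a b H.
  repeat split; eexists; [apply D1|apply D2|apply D12|apply D21]; trivial.
- apply continuity_2d_pt_ext_loc with (fun a b => dir v (dir w F) (line2 x v w a b)).
  + revert L0; apply locally_2d_impl, locally_2d_forall; intros a b H.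
    symmetry; now apply is_derive_unique, D12.
  + apply C, Ck_dir, Ck_dir, HF.
- apply continuity_2d_pt_ext_loc with (fun a b => dir w (dir v F) (line2 x v w a b)).
  + revert L0; apply locally_2d_impl, locally_2d_forall; intros a b H.
    symmetry; now apply is_derive_unique, D21.
  + apply C, Ck_dir, Ck_dir, HF.
Qed.

(** * Smooth functions and derivations on the sphere *)

Lemma scal_vec c (x : R3) : scal c x = vec (c * cx x) (c * cy x) (c * cz x).
Proof. now destruct x as [[a b] d]. Qed.

Lemma S2_ext p q : pt p = pt q -> p = q.
Proof.
destruct p as [p Hp], q as [q Hq]; cbn; intros E; subst q.
f_equal; apply proof_irrelevance.
Qed.

Lemma pt_nonzero p : pt p <> zero.
Proof. intros E. apply dot_zero_iff in E. rewrite (pt_unit p) in E. lra. Qed.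

Lemma pt_rproj x : x <> zero -> pt (rproj x) = scal (rnorm x) x.
Proof.
intros Hx; unfold rproj. destruct Req_EM_T as [E|E].
- now apply dot_zero_iff in E.
- apply R3_ext; apply Rmult_comm.
Qed.

Lemma rnorm_pt p : rnorm (pt p) = 1.
Proof. unfold rnorm. rewrite (pt_unit p), sqrt_1; field. Qed.

Lemma rproj_pt p : rproj (pt p) = p.
Proof.
apply S2_ext. rewrite (pt_rproj _ (pt_nonzero p)), rnorm_pt.
rewrite scal_vec; apply R3_ext; cbn; ring.
Qed.

Lemma dot_scal c x : dot (scal c x) (scal c x) = c * c * dot x x.
Proof. rewrite scal_vec; unfold dot; cbn; ring. Qed.

Lemma rproj_scal c x : 0 < c -> rproj (scal c x) = rproj x.
Proof.
intros Hc.
destruct (Req_EM_T (dot x x) 0) as [E|E].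
- apply dot_zero_iff in E; subst x. f_equal. rewrite scal_vec; apply R3_ext; cbn; ring.
- apply S2_ext.
  assert (Hx : x <> zero) by (intros H; now apply E, dot_zero_iff).
  rewrite !pt_rproj; trivial.
  + assert (H := sqrt_lt_R0 _ (dot_pos x Hx)).
    unfold rnorm; rewrite dot_scal, sqrt_mult, sqrt_square;
      [|lra|nra|apply dot_self_ge0].
    rewrite !scal_vec; apply R3_ext; cbn; field; lra.
  + intros H; apply dot_zero_iff in H; rewrite dot_scal in H.
    apply Rmult_integral in H; destruct H; [nra|easy].
Qed.

(** The extension to space that is constant on rays. *)
Definition amb (f : S2 -> R) : R3 -> R := fun x => f (rproj x).

Lemma dS_dir f p v : dS f p v = dir v (amb f) (pt p).
Proof. reflexivity. Qed.

Lemma rnorm_pos x : x <> zero -> 0 < rnorm x.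
Proof. intros Hx; apply Rinv_0_lt_compat, sqrt_lt_R0, dot_pos, Hx. Qed.

Lemma rnorm_dot x : x <> zero -> dot x x * rnorm x = / rnorm x.
Proof.
intros Hx; unfold rnorm. assert (H := sqrt_lt_R0 _ (dot_pos x Hx)).
rewrite <- (sqrt_sqrt (dot x x)) at 1 by apply dot_self_ge0. field; lra.
Qed.

(** The extension is homogeneous of degree 0, hence its derivatives are
    homogeneous of degree -1. *)
Lemma amb_dS f v x :
  smooth f -> x <> zero ->
  amb (fun p => dS f p v) x = dot x x * rnorm x * dir v (amb f) x.
Proof.
intros Hf Hx. unfold amb at 1; rewrite dS_dir, rnorm_dot by trivial.
assert (H := rnorm_pos x Hx).
unfold dir at 1; apply is_derive_unique.
apply is_derive_ext with (fun t => amb f (line x v (/ rnorm x * t))).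
{ intros t; unfold amb; rewrite pt_rproj by trivial.
  rewrite <- (rproj_scal (rnorm x)) by trivial. do 2 f_equal.
  rewrite !line_vec; rewrite !scal_vec; apply R3_ext; cbn; field; lra. }
apply (is_derive_comp (K := R_AbsRing) (V := R_NormedModule)
        (fun s => amb f (line x v s)) (fun t => / rnorm x * t)).
- rewrite Rmult_0_r. apply Derive_correct. now apply (Ck_ex_derive 0 (amb f)).
- auto_derive; trivial; ring.
Qed.

Definition px (p : S2) : R := cx (pt p).
Definition py (p : S2) : R := cy (pt p).
Definition pz (p : S2) : R := cz (pt p).

Lemma unit_coord p : px p * px p + py p * py p + pz p * pz p = 1.
Proof. exact (pt_unit p). Qed.

(** Pointwise operations as constants, so that the rules for derivations are first-order
    rewriting rules. *)
Declare Scope sphere_scope.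
Delimit Scope sphere_scope with sph.
Definition fadd (f g : S2 -> R) : S2 -> R := fun p => f p + g p.
Definition fmul (f g : S2 -> R) : S2 -> R := fun p => f p * g p.
Definition fcst (c : R) : S2 -> R := fun _ => c.
Definition fexp (f : S2 -> R) : S2 -> R := fun p => exp (f p).
Infix "+" := fadd : sphere_scope.
Infix "*" := fmul : sphere_scope.
Notation "# c" := (fcst c) (at level 1, format "# c") : sphere_scope.
Notation "f - g" := (fadd f (fmul (fcst (-1)) g)) : sphere_scope.

Lemma smooth_cst c : smooth (fcst c).
Proof. intros k; exact (Ck_const k c). Qed.
Lemma smooth_add f g : smooth f -> smooth g -> smooth (fadd f g).
Proof. intros Hf Hg k; apply (Ck_plus k (amb f) (amb g)); [apply Hf|apply Hg]. Qed.
Lemma smooth_mul f g : smooth f -> smooth g -> smooth (fmul f g).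
Proof. intros Hf Hg k; apply (Ck_mult k (amb f) (amb g)); [apply Hf|apply Hg]. Qed.
Lemma smooth_exp f : smooth f -> smooth (fexp f).
Proof. intros Hf k; apply (Ck_exp k (amb f)), Hf. Qed.
Lemma smooth_px : smooth px.
Proof.
intros k; apply Ck_ext with (fun x => rnorm x * cx x).
- intros x Hx; unfold px; now rewrite pt_rproj.
- apply Ck_mult; [apply Ck_rnorm|apply Ck_cx].
Qed.
Lemma smooth_py : smooth py.
Proof.
intros k; apply Ck_ext with (fun x => rnorm x * cy x).
- intros x Hx; unfold py; now rewrite pt_rproj.
- apply Ck_mult; [apply Ck_rnorm|apply Ck_cy].
Qed.
Lemma smooth_pz : smooth pz.
Proof.
intros k; apply Ck_ext with (fun x => rnorm x * cz x).
- intros x Hx; unfold pz; now rewrite pt_rproj.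
- apply Ck_mult; [apply Ck_rnorm|apply Ck_cz].
Qed.

Lemma smooth_dS f v : smooth f -> smooth (fun p => dS f p v).
Proof.
intros Hf k; apply Ck_ext with (fun x => dot x x * rnorm x * dir v (amb f) x).
- intros x Hx; symmetry; now apply amb_dS.
- repeat apply Ck_mult; [apply Ck_dot|apply Ck_rnorm|].
  apply Ck_dir, Hf.
Qed.

Lemma is_derive_amb f (x y z : R -> R) (x' y' z' t : R) :
  let p := vec (x t) (y t) (z t) in
  smooth f -> p <> zero ->
  is_derive x t x' -> is_derive y t y' -> is_derive z t z' ->
  is_derive (fun s => amb f (vec (x s) (y s) (z s))) t
    (x' * dir e_x (amb f) p + y' * dir e_y (amb f) p + z' * dir e_z (amb f) p).
Proof.
intros p Hf Hp; apply is_derive_curve; fold p.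
- generalize (locally_nonzero p Hp); apply filter_imp; intros q Hq v.
  now apply (Ck_ex_derive 0 (amb f)).
- intros v; apply (Ck_continuous 0); trivial. apply Ck_dir, Hf.
Qed.

Lemma dS_linear f p v : smooth f ->
  dS f p v = cx v * dS f p e_x + cy v * dS f p e_y + cz v * dS f p e_z.
Proof.
intros Hf; unfold dS at 1; apply is_derive_unique.
apply is_derive_ext with
  (fun t => amb f (vec (px p + t * cx v) (py p + t * cy v) (pz p + t * cz v))).
{ intros t; now rewrite line_vec. }
rewrite !dS_dir.
assert (E : pt p = vec (px p + 0 * cx v) (py p + 0 * cy v) (pz p + 0 * cz v)).
{ apply R3_ext; unfold px, py, pz; cbn; ring. }
rewrite E.
apply (is_derive_amb f (fun t => px p + t * cx v) (fun t => py p + t * cy v)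
         (fun t => pz p + t * cz v)); trivial.
- rewrite <- E; apply pt_nonzero.
- auto_derive; trivial; ring.
- auto_derive; trivial; ring.
- auto_derive; trivial; ring.
Qed.

Lemma dS_radial f p (c : R) : dS f p (scal c (pt p)) = 0.
Proof.
unfold dS. rewrite (Derive_ext_loc _ (fun _ => f p)); [apply Derive_const|].
assert (L : locally 0 (fun t => 0 < 1 + t * c)).
{ assert (C : continuous (fun t => 1 + t * c) 0).
  { apply (ex_derive_continuous (V := R_NormedModule)); now auto_derive. }
  apply (C (fun r => 0 < r)), (open_gt 0). rewrite Rmult_0_l, Rplus_0_r; lra. }
revert L; apply filter_imp; intros t Ht. f_equal.
rewrite <- (rproj_pt p) at 3. rewrite <- (rproj_scal _ (pt p) Ht). f_equal.
rewrite line_vec, !scal_vec; apply R3_ext; cbn; ring.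
Qed.

Lemma dS_tangency f p : smooth f ->
  px p * dS f p e_x + py p * dS f p e_y + pz p * dS f p e_z = 0.
Proof.
intros Hf. rewrite <- (dS_radial f p 1), (dS_linear f p (scal 1 (pt p))) by trivial.
rewrite scal_vec; unfold px, py, pz; cbn; ring.
Qed.

Lemma is_derive_eq (f : R -> R) (x l l' : R) : is_derive f x l -> l = l' -> is_derive f x l'.
Proof. now intros H <-. Qed.

(** The extension of a derivative is [|x|] times a derivative of the extension;
    the derivative of the factor [|x|] produces the commutator. *)
Lemma dS_comm f p v w : smooth f ->
  dS (fun q => dS f q w) p v - dS (fun q => dS f q v) p w
  = dot (pt p) v * dS f p w - dot (pt p) w * dS f p v.
Proof.
intros Hf.
assert (E : forall v w, dS (fun q => dS f q w) p v =
   dot (pt p) v * dS f p w + dir v (dir w (amb f)) (pt p)).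
{ clear v w; intros v w. rewrite !dS_dir.
  assert (Hp := pt_nonzero p).
  rewrite (dir_ext_loc _ (fun x => dot x x * rnorm x * dir w (amb f) x)).
  2:{ generalize (locally_nonzero _ Hp); apply filter_imp; intros x Hx. now apply amb_dS. }
  unfold dir at 1; apply is_derive_unique.
  assert (H1 : ex_derive (fun t => dir w (amb f) (line (pt p) v t)) 0).
  { apply (Ck_ex_derive 0); trivial. apply Ck_dir, Hf. }
  apply Derive_correct in H1.
  change (Derive _ 0) with (dir v (dir w (amb f)) (pt p)) in H1.
  assert (H2 := is_derive_rnorm (pt p) v Hp).
  assert (H3 : is_derive (fun t => dot (line (pt p) v t) (line (pt p) v t)) 0 (2 * dot (pt p) v)).
  { unfold dot. apply is_derive_ext with
     (fun t => (px p + t * cx v) * (px p + t * cx v) + (py p + t * cy v) * (py p + t * cy v)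
       + (pz p + t * cz v) * (pz p + t * cz v)).
    { intros t; now rewrite line_vec. }
    auto_derive; trivial; unfold px, py, pz; ring. }
  assert (H4 := is_derive_mult _ _ 0 _ _ (is_derive_mult _ _ 0 _ _ H3 H2 Rmult_comm) H1 Rmult_comm).
  cbn beta in H4. rewrite line_0, rnorm_pt, (pt_unit p) in H4.
  eapply is_derive_eq; [exact H4|].
  unfold plus, mult, dot; cbn; ring. }
rewrite !E, (dir_comm _ _ v w); [ring|apply Hf|apply pt_nonzero].
Qed.

(** * The Mercator frame *)

Definition dx (f : S2 -> R) : S2 -> R := fun p => dS f p e_x.
Definition dy (f : S2 -> R) : S2 -> R := fun p => dS f p e_y.
Definition dz (f : S2 -> R) : S2 -> R := fun p => dS f p e_z.

(** The squared sine of the colatitude; it vanishes exactly at the poles. *)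
Definition sinsq : S2 -> R := (px * px + py * py)%sph.

(** Minus the gradient of the height. *)
Definition mer (p : S2) : R3 := vec (pz p * px p) (pz p * py p) (- sinsq p).
(** The rotation about the polar axis. *)
Definition rot (p : S2) : R3 := vec (- py p) (px p) 0.

Definition D1 : (S2 -> R) -> S2 -> R := lieD mer.
Definition D2 : (S2 -> R) -> S2 -> R := lieD rot.

Ltac sph_unfold := unfold fadd, fmul, fcst, fexp.
Ltac sph_ext p := apply functional_extensionality; intros p; sph_unfold.

Lemma dS_line_ex f p v : smooth f -> ex_derive (fun t => amb f (line (pt p) v t)) 0.
Proof. intros Hf; apply (Ck_ex_derive 0); [apply Hf|apply pt_nonzero]. Qed.

Lemma lieD_cst V c : lieD V (fcst c) = fcst 0.
Proof. sph_ext p. apply (Derive_const c). Qed.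

Lemma lieD_add V f g : smooth f -> smooth g -> lieD V (f + g)%sph = (lieD V f + lieD V g)%sph.
Proof. intros Hf Hg; sph_ext p. apply Derive_plus; now apply (dS_line_ex _ p). Qed.

Lemma lieD_mul V f g : smooth f -> smooth g ->
  lieD V (f * g)%sph = (lieD V f * g + f * lieD V g)%sph.
Proof.
intros Hf Hg; sph_ext p. unfold lieD; rewrite !dS_dir.
change (amb (fun p => f p * g p)) with (fun x => amb f x * amb g x).
rewrite (dir_mult 0); [|apply Hf|apply Hg|apply pt_nonzero].
unfold amb at 2 3; now rewrite rproj_pt.
Qed.

Lemma lieD_exp V f : smooth f -> lieD V (fexp f) = (lieD V f * fexp f)%sph.
Proof.
intros Hf; sph_ext p. unfold lieD, dS. apply is_derive_unique.
eapply is_derive_eq; [apply (is_derive_exp_comp (fun t => amb f (line (pt p) (V p) t)))|].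
now apply dS_line_ex.
rewrite line_0. unfold amb at 2; now rewrite rproj_pt.
Qed.

(** Coordinate functions: restriction of a linear form [F], as [F x / |x|]. *)
Lemma dS_coord (F : R3 -> R) p v :
  (forall t, F (line (pt p) v t) = F (pt p) + t * F v) ->
  (forall x, x <> zero -> F (pt (rproj x)) = rnorm x * F x) ->
  dS (fun q => F (pt q)) p v = F v - dot (pt p) v * F (pt p).
Proof.
intros HF HR; unfold dS; apply is_derive_unique.
apply is_derive_ext_loc with
  (fun t => rnorm (line (pt p) v t) * (F (pt p) + t * F v)).
{ generalize (locally_line_nonzero _ v (pt_nonzero p)); apply filter_imp; intros t Ht.
  now rewrite HR, HF. }
assert (H1 : is_derive (fun t => F (pt p) + t * F v) 0 (F v)).
{ auto_derive; trivial; ring. }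
eapply is_derive_eq.
apply (is_derive_mult _ _ 0 _ _ (is_derive_rnorm _ v (pt_nonzero p)) H1 Rmult_comm).
rewrite line_0, rnorm_pt. unfold plus, mult, dot; cbn; ring.
Qed.

Lemma dS_px p v : dS px p v = cx v - dot (pt p) v * px p.
Proof.
apply (dS_coord cx); [intros; now rewrite line_vec|].
intros x Hx; now rewrite pt_rproj.
Qed.
Lemma dS_py p v : dS py p v = cy v - dot (pt p) v * py p.
Proof.
apply (dS_coord cy); [intros; now rewrite line_vec|].
intros x Hx; now rewrite pt_rproj.
Qed.
Lemma dS_pz p v : dS pz p v = cz v - dot (pt p) v * pz p.
Proof.
apply (dS_coord cz); [intros; now rewrite line_vec|].
intros x Hx; now rewrite pt_rproj.
Qed.

Lemma sinsq_eq p : sinsq p = 1 - pz p * pz p.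
Proof. generalize (unit_coord p); unfold sinsq; sph_unfold; lra. Qed.

Lemma dot_mer p : dot (pt p) (mer p) = 0.
Proof.
unfold dot, mer; cbn. fold (px p) (py p) (pz p). unfold sinsq; sph_unfold; ring.
Qed.
Lemma dot_rot p : dot (pt p) (rot p) = 0.
Proof. unfold dot, rot; cbn. fold (px p) (py p) (pz p). ring. Qed.

Lemma dot_mer_mer p : dot (mer p) (mer p) = sinsq p.
Proof.
unfold dot, mer; cbn [cx cy cz vec fst snd].
transitivity (pz p * pz p * sinsq p + sinsq p * sinsq p);
  [unfold sinsq at 3; sph_unfold; ring|rewrite (sinsq_eq p); ring].
Qed.
Lemma dot_rot_rot p : dot (rot p) (rot p) = sinsq p.
Proof. unfold dot, rot, sinsq; sph_unfold; cbn [cx cy cz vec fst snd]; ring. Qed.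
Lemma dot_mer_rot p : dot (mer p) (rot p) = 0.
Proof. unfold dot, mer, rot; cbn [cx cy cz vec fst snd]; ring. Qed.

Lemma D1_px : D1 px = (pz * px)%sph.
Proof. sph_ext p. unfold D1, lieD. rewrite dS_px, dot_mer. cbn; ring. Qed.
Lemma D1_py : D1 py = (pz * py)%sph.
Proof. sph_ext p. unfold D1, lieD. rewrite dS_py, dot_mer. cbn; ring. Qed.
Lemma D1_pz : D1 pz = (#(-1) * sinsq)%sph.
Proof. sph_ext p. unfold D1, lieD. rewrite dS_pz, dot_mer. cbn; ring. Qed.
Lemma D2_px : D2 px = (#(-1) * py)%sph.
Proof. sph_ext p. unfold D2, lieD. rewrite dS_px, dot_rot. cbn; ring. Qed.
Lemma D2_py : D2 py = px.
Proof. sph_ext p. unfold D2, lieD. rewrite dS_py, dot_rot. cbn; ring. Qed.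
Lemma D2_pz : D2 pz = #0%sph.
Proof. sph_ext p. unfold D2, lieD. rewrite dS_pz, dot_rot. cbn; ring. Qed.

Lemma D1_cst c : D1 (fcst c) = fcst 0. Proof. apply lieD_cst. Qed.
Lemma D2_cst c : D2 (fcst c) = fcst 0. Proof. apply lieD_cst. Qed.
Lemma D1_add f g : smooth f -> smooth g -> D1 (f + g)%sph = (D1 f + D1 g)%sph.
Proof. apply lieD_add. Qed.
Lemma D2_add f g : smooth f -> smooth g -> D2 (f + g)%sph = (D2 f + D2 g)%sph.
Proof. apply lieD_add. Qed.
Lemma D1_mul f g : smooth f -> smooth g -> D1 (f * g)%sph = (D1 f * g + f * D1 g)%sph.
Proof. apply lieD_mul. Qed.
Lemma D2_mul f g : smooth f -> smooth g -> D2 (f * g)%sph = (D2 f * g + f * D2 g)%sph.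
Proof. apply lieD_mul. Qed.
Lemma D1_exp f : smooth f -> D1 (fexp f) = (D1 f * fexp f)%sph.
Proof. apply lieD_exp. Qed.
Lemma D2_exp f : smooth f -> D2 (fexp f) = (D2 f * fexp f)%sph.
Proof. apply lieD_exp. Qed.

Lemma smooth_dx f : smooth f -> smooth (dx f). Proof. apply smooth_dS. Qed.
Lemma smooth_dy f : smooth f -> smooth (dy f). Proof. apply smooth_dS. Qed.
Lemma smooth_dz f : smooth f -> smooth (dz f). Proof. apply smooth_dS. Qed.
Lemma smooth_sinsq : smooth sinsq.
Proof. unfold sinsq; auto using smooth_add, smooth_mul, smooth_px, smooth_py. Qed.

Lemma D1_dz f : smooth f -> D1 f = (#(-1) * dz f)%sph.
Proof.
intros Hf; sph_ext p. unfold D1, lieD, dz. rewrite (dS_linear f p (mer p)) by trivial.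
assert (T := dS_tangency f p Hf). assert (U := unit_coord p).
unfold mer; cbn [cx cy cz vec fst snd]. rewrite sinsq_eq.
replace (_ + _) with (pz p * (px p * dS f p e_x + py p * dS f p e_y + pz p * dS f p e_z)
   - dS f p e_z) by ring. rewrite T; ring.
Qed.

Lemma D2_dxy f : smooth f -> D2 f = (px * dy f - py * dx f)%sph.
Proof.
intros Hf; sph_ext p. unfold D2, lieD, dx, dy. rewrite (dS_linear f p (rot p)) by trivial.
unfold rot; cbn [cx cy cz vec fst snd]. ring.
Qed.

Lemma smooth_D1 f : smooth f -> smooth (D1 f).
Proof. intros Hf; rewrite D1_dz by trivial. auto using smooth_mul, smooth_cst, smooth_dz. Qed.
Lemma smooth_D2 f : smooth f -> smooth (D2 f).
Proof.
intros Hf; rewrite D2_dxy by trivial.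
auto 8 using smooth_add, smooth_mul, smooth_cst, smooth_dx, smooth_dy, smooth_px, smooth_py.
Qed.

Create HintDb smooth.
#[export] Hint Resolve smooth_cst smooth_add smooth_mul smooth_exp smooth_px smooth_py smooth_pz
  smooth_sinsq smooth_dx smooth_dy smooth_dz smooth_D1 smooth_D2 : smooth.
Ltac smooth := auto 40 with smooth.

Lemma D1_sinsq : D1 sinsq = (#2 * pz * sinsq)%sph.
Proof.
unfold sinsq. rewrite D1_add, !D1_mul, D1_px, D1_py by smooth. sph_ext p; ring.
Qed.
Lemma D2_sinsq : D2 sinsq = #0%sph.
Proof.
unfold sinsq. rewrite D2_add, !D2_mul, D2_px, D2_py by smooth. sph_ext p; ring.
Qed.

(** [mer] and [rot] are the coordinate fields of the Mercator projection. *)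
Lemma D_comm f : smooth f -> D1 (D2 f) = D2 (D1 f).
Proof.
intros Hf.
rewrite (D1_dz (D2 f)), (D2_dxy (D1 f)), (D2_dxy f), (D1_dz f) by smooth.
unfold dx, dy, dz.
change (fun p => dS ?g p ?e) with (lieD (fun _ => e) g).
rewrite !lieD_add, !lieD_mul, !lieD_cst by (auto 40 using smooth_dS with smooth).
sph_ext p. unfold lieD; cbv beta.
rewrite dS_px, dS_py.
assert (C1 := dS_comm f p e_y e_z Hf). assert (C2 := dS_comm f p e_x e_z Hf).
assert (T := dS_tangency f p Hf).
unfold dot in *; cbn [cx cy cz vec fst snd e_x e_y e_z] in *.
fold (px p) (py p) (pz p) in *.
unfold e_x, e_y, e_z in *; cbn [cx cy cz vec fst snd] in *.
nra.
Qed.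

(** [D1_dz] and [D2_dxy], solved for the gradient by means of [dS_tangency]. *)

Lemma sinsq_dx f : smooth f -> (sinsq * dx f = px * pz * D1 f - py * D2 f)%sph.
Proof.
intros Hf. rewrite D1_dz, D2_dxy by trivial. sph_ext p.
assert (T := dS_tangency f p Hf). fold (dx f p) (dy f p) (dz f p) in T.
unfold sinsq; sph_unfold. apply Rminus_diag_uniq.
transitivity (px p * (px p * dx f p + py p * dy f p + pz p * dz f p));
  [ring|rewrite T; ring].
Qed.

Lemma sinsq_dy f : smooth f -> (sinsq * dy f = py * pz * D1 f + px * D2 f)%sph.
Proof.
intros Hf. rewrite D1_dz, D2_dxy by trivial. sph_ext p.
assert (T := dS_tangency f p Hf). fold (dx f p) (dy f p) (dz f p) in T.
unfold sinsq; sph_unfold. apply Rminus_diag_uniq.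
transitivity (py p * (px p * dx f p + py p * dy f p + pz p * dz f p));
  [ring|rewrite T; ring].
Qed.

Lemma dz_D1 f : smooth f -> (dz f = #(-1) * D1 f)%sph.
Proof. intros Hf; rewrite D1_dz by trivial; sph_ext p; ring. Qed.

Lemma sinsq_pole p : sinsq p = 0 -> px p = 0 /\ py p = 0.
Proof. unfold sinsq; sph_unfold; nra. Qed.

Lemma sinsq_pos p : sinsq p <> 0 -> 0 < sinsq p.
Proof. unfold sinsq; sph_unfold; intros H; nra. Qed.

Lemma D1_pole f p : smooth f -> sinsq p = 0 -> D1 f p = 0.
Proof.
intros Hf Hp. apply sinsq_pole in Hp; destruct Hp as [Hx Hy].
assert (U := unit_coord p). assert (T := dS_tangency f p Hf).
rewrite D1_dz by trivial. unfold dz; sph_unfold. rewrite Hx, Hy in U, T.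
enough (dS f p e_z = 0) as -> by ring.
apply Rmult_eq_reg_l with (pz p); [lra|]. intros E; rewrite E in U; lra.
Qed.

(** By continuity, since the poles are limits of other points. *)
Lemma smooth_eq f g : smooth f -> smooth g ->
  (forall p, sinsq p <> 0 -> f p = g p) -> f = g.
Proof.
intros Hf Hg H.
set (h := (f - g)%sph). assert (Hh : smooth h) by (unfold h; smooth).
assert (H0 : forall p, sinsq p <> 0 -> h p = 0).
{ intros p Hp; unfold h; sph_unfold; rewrite (H p Hp); ring. }
enough (E : forall p, h p = 0).
{ sph_ext p. generalize (E p); unfold h; sph_unfold; lra. }
intros p. destruct (Req_EM_T (sinsq p) 0) as [Hp|Hp]; [|now apply H0].
apply sinsq_pole in Hp; destruct Hp as [Hx Hy].
assert (C : continuous (fun t => amb h (line (pt p) e_x t)) 0).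
{ apply (continuous_comp (line (pt p) e_x) (amb h)).
  - apply continuous_line.
  - rewrite line_0. apply (Ck_continuous 0); [apply Hh|apply pt_nonzero]. }
assert (Z : forall t, t <> 0 -> amb h (line (pt p) e_x t) = 0).
{ intros t Ht; apply H0.
  set (y := line (pt p) e_x t).
  assert (Ey : y = vec t 0 (pz p)).
  { unfold y; rewrite line_vec; fold (px p) (py p) (pz p); rewrite Hx, Hy.
    apply R3_ext; cbn; ring. }
  assert (Ny : y <> zero).
  { intros E; apply (f_equal cx) in E; rewrite Ey in E; now cbn in E. }
  unfold sinsq, px, py; sph_unfold. rewrite pt_rproj, scal_vec, Ey by trivial.
  assert (Hr := rnorm_pos _ Ny). rewrite Ey in Hr. cbn.
  assert (N : rnorm (vec t 0 (pz p)) * t <> 0) by (apply Rmult_integral_contrapositive; split; lra).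
  intros E; nra. }
destruct (Req_dec (h p) 0) as [E|E]; [trivial|exfalso].
assert (L : locally 0 (fun t => amb h (line (pt p) e_x t) <> 0)).
{ apply (C (fun r => r <> 0)), (open_neq 0). unfold amb; now rewrite line_0, rproj_pt. }
destruct L as [d Hd]. assert (Pd := cond_pos d).
apply (Hd (d / 2)).
- change (Rabs (d / 2 - 0) < d). apply Rabs_def1; lra.
- apply Z; lra.
Qed.

Lemma sinsq_cancel f g : smooth f -> smooth g -> (sinsq * f = sinsq * g)%sph -> f = g.
Proof.
intros Hf Hg E; apply smooth_eq; trivial.
intros p Hp; apply Rmult_eq_reg_l with (sinsq p); [|easy].
now apply (f_equal (fun h => h p)) in E.
Qed.

(** Differentiation is local, and the complement of the poles is open. *)
Lemma lieD_local V f g p : sinsq p <> 0 ->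
  (forall q, sinsq q <> 0 -> f q = g q) -> lieD V f p = lieD V g p.
Proof.
intros Hp H. unfold lieD; rewrite !dS_dir. apply dir_ext_loc.
assert (C : continuous (amb sinsq) (pt p)).
{ apply (Ck_continuous 0); [apply smooth_sinsq|apply pt_nonzero]. }
assert (N : amb sinsq (pt p) <> 0) by (unfold amb; now rewrite rproj_pt).
assert (L := C (fun r => r <> 0) (open_neq 0 _ N)).
unfold filtermap in L; revert L; apply filter_imp; intros x; apply H.
Qed.

Definition ginner (f h : S2 -> R) : S2 -> R := (dx f * dx h + dy f * dy h + dz f * dz h)%sph.

Lemma smooth_ginner f h : smooth f -> smooth h -> smooth (ginner f h).
Proof. intros; unfold ginner; smooth. Qed.
#[export] Hint Resolve smooth_ginner : smooth.

Lemma sinsq_ginner f h : smooth f -> smooth h -> (sinsq * ginner f h = D1 f * D1 h + D2 f * D2 h)%sph.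
Proof.
intros Hf Hh. rewrite !D1_dz, !D2_dxy by trivial. unfold ginner, sinsq; sph_ext p.
assert (T := dS_tangency f p Hf). fold (dx f p) (dy f p) (dz f p) in T.
assert (T' := dS_tangency h p Hh). fold (dx h p) (dy h p) (dz h p) in T'.
assert (U := unit_coord p).
assert (S : px p * dx f p + py p * dy f p = - (pz p * dz f p)) by lra.
assert (S' : px p * dx h p + py p * dy h p = - (pz p * dz h p)) by lra.
transitivity ((px p * dx f p + py p * dy f p) * (px p * dx h p + py p * dy h p)
  + (px p * dy f p - py p * dx f p) * (px p * dy h p - py p * dx h p)
  + (1 - pz p * pz p) * dz f p * dz h p).
- rewrite <- U; ring.
- rewrite S, S'; ring.
Qed.

(** The Laplace-Beltrami operator, as the sum of the squares of the tangential parts of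
    the coordinate derivatives. *)
Definition Lap (f : S2 -> R) : S2 -> R := (dx (dx f) + dy (dy f) + dz (dz f))%sph.

Lemma smooth_Lap f : smooth f -> smooth (Lap f).
Proof. intros; unfold Lap; smooth. Qed.
#[export] Hint Resolve smooth_Lap : smooth.

(** Pushes [D1] and [D2] to the leaves, with [D2] outermost in iterated derivatives. *)
Ltac derive :=
  repeat first
    [ rewrite D1_add by smooth | rewrite D1_mul by smooth | rewrite D1_exp by smooth
    | rewrite D2_add by smooth | rewrite D2_mul by smooth | rewrite D2_exp by smooth
    | rewrite D1_cst | rewrite D2_cst | rewrite D1_px | rewrite D1_py | rewrite D1_pz
    | rewrite D2_px | rewrite D2_py | rewrite D2_pz | rewrite D1_sinsq | rewrite D2_sinsq
    | rewrite D_comm by smooth ].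
Ltac derive_in H :=
  repeat first
    [ rewrite D1_add in H by smooth | rewrite D1_mul in H by smooth | rewrite D1_exp in H by smooth
    | rewrite D2_add in H by smooth | rewrite D2_mul in H by smooth | rewrite D2_exp in H by smooth
    | rewrite D1_cst in H | rewrite D2_cst in H | rewrite D1_px in H | rewrite D1_py in H
    | rewrite D1_pz in H | rewrite D2_px in H | rewrite D2_py in H | rewrite D2_pz in H
    | rewrite D1_sinsq in H | rewrite D2_sinsq in H | rewrite D_comm in H by smooth ].
Ltac at_point H p := apply (f_equal (fun h : S2 -> R => h p)) in H; unfold fadd, fmul, fcst, fexp in H.


(** The shapes produced by differentiating [sinsq * t = c] zero, one and two times. *)
Lemma solve0 a t c : a <> 0 -> a * t = c -> t = c / a.
Proof. intros Ha <-; now field. Qed.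
Lemma solve1 a b t c : a <> 0 -> b + a * t = c -> t = (c - b) / a.
Proof. intros Ha <-; now field. Qed.
Lemma solve2 a b b' t c : a <> 0 -> b + (b' + a * t) = c -> t = (c - b - b') / a.
Proof. intros Ha <-; now field. Qed.

Lemma sinsq_Lap f : smooth f -> (sinsq * Lap f = D1 (D1 f) + D2 (D2 f))%sph.
Proof.
intros Hf. apply smooth_eq; [smooth..|]. intros p Hp.
assert (Ex := sinsq_dx (dx f) ltac:(smooth)). assert (Ey := sinsq_dy (dy f) ltac:(smooth)).
assert (Ez := dz_D1 (dz f) ltac:(smooth)). rewrite (dz_D1 f Hf) in Ez.
assert (X := sinsq_dx f Hf). assert (Y := sinsq_dy f Hf).
assert (X1 := f_equal D1 X). assert (X2 := f_equal D2 X).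
assert (Y1 := f_equal D1 Y). assert (Y2 := f_equal D2 Y).
derive_in Ez; derive_in X1; derive_in X2; derive_in Y1; derive_in Y2.
unfold Lap. rewrite (dz_D1 f Hf).
at_point Ex p; at_point Ey p; at_point Ez p; at_point X1 p; at_point X2 p; at_point Y1 p; at_point Y2 p.
at_point X p; at_point Y p. sph_unfold.
apply solve0 in Ex, Ey, X, Y; trivial. apply solve1 in X1, X2, Y1, Y2; trivial.
rewrite Ex, Ey, Ez, X1, X2, Y1, Y2, X, Y.
assert (U := unit_coord p). assert (W := sinsq_eq p).
assert (P2 : px p ^ 2 = sinsq p - py p ^ 2) by (unfold sinsq; sph_unfold; ring).
assert (Z2 : pz p ^ 2 = 1 - sinsq p) by (rewrite W; ring).
field_simplify_eq; [|easy].
ring [P2 Z2].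
Qed.

(** * Integration over the sphere *)

Lemma continuous_RInt_param (g : R -> R -> R) (a b t0 : R) :
  a <= b -> (forall t s, continuity_2d_pt g t s) ->
  continuous (fun t => RInt (g t) a b) t0.
Proof.
intros Hab Hg.
assert (Hi : forall t, ex_RInt (g t) a b).
{ intros t; apply (ex_RInt_continuous (V := R_CompleteNormedModule)); intros s _.
  apply (continuous_comp_2 (fun _ => t) (fun s => s) g).
  - apply continuous_const.
  - apply continuous_id.
  - apply continuity_2d_pt_filterlim, Hg. }
apply filterlim_locally; intros eps.
assert (He : 0 < eps / (b - a + 1)) by (apply Rdiv_lt_0_compat; [apply cond_pos|lra]).
destruct (uniform_continuity_2d_1d' g a b t0 (fun s _ => Hg t0 s) (mkposreal _ He)) as [d Hd].
assert (Pd := cond_pos d).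
exists d; intros t Ht. change (Rabs (t - t0) < d) in Ht.
change (Rabs (RInt (g t) a b - RInt (g t0) a b) < eps).
assert (M := RInt_minus (V := R_CompleteNormedModule) (g t) (g t0) a b (Hi t) (Hi t0)).
change (RInt (fun s => g t s - g t0 s) a b = RInt (g t) a b - RInt (g t0) a b) in M.
rewrite <- M.
apply Rabs_def2 in Ht.
apply Rle_lt_trans with ((b - a) * (eps / (b - a + 1))).
- apply (abs_RInt_le_const (fun s => g t s - g t0 s)); trivial.
  + apply (ex_RInt_minus (V := R_CompleteNormedModule) (g t) (g t0) a b (Hi t) (Hi t0)).
  + intros s Hs. left. apply (Hd s t0 s t); try lra.
    replace (s - s) with 0 by ring; rewrite Rabs_R0; trivial.
- assert (Pe := cond_pos eps).
  replace ((b - a) * (eps / (b - a + 1))) with (eps - eps / (b - a + 1)) by (field; lra).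
  lra.
Qed.

Lemma RInt_nonneg_eq_0 (g : R -> R) a b x :
  (forall t, continuous g t) -> (forall t, a <= t <= b -> 0 <= g t) ->
  RInt g a b = 0 -> a < x < b -> g x = 0.
Proof.
intros Hc Hp HI Hx.
destruct (Req_dec (g x) 0) as [E|E]; [trivial|exfalso].
assert (Hgx : 0 < g x) by (assert (H := Hp x); lra).
destruct (Hc x (fun r => 0 < r) (open_gt 0 _ Hgx)) as [d Hd].
assert (Pd := cond_pos d).
set (c1 := Rmax a (x - d / 2)). set (c2 := Rmin b (x + d / 2)).
assert (H1 : a <= c1 /\ x - d / 2 <= c1 < x).
{ unfold c1; repeat split; [apply Rmax_l|apply Rmax_r|apply Rmax_lub_lt; lra]. }
assert (H2 : c2 <= b /\ x < c2 <= x + d / 2).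
{ unfold c2; repeat split; [apply Rmin_l|apply Rmin_glb_lt; lra|apply Rmin_r]. }
assert (Hi : forall u v, ex_RInt g u v).
{ intros u v; apply (ex_RInt_continuous (V := R_CompleteNormedModule)); intros; apply Hc. }
assert (E1 := RInt_Chasles (V := R_CompleteNormedModule) g a c1 b (Hi _ _) (Hi _ _)).
assert (E2 := RInt_Chasles (V := R_CompleteNormedModule) g c1 c2 b (Hi _ _) (Hi _ _)).
change (RInt g a c1 + RInt g c1 b = RInt g a b) in E1.
change (RInt g c1 c2 + RInt g c2 b = RInt g c1 b) in E2.
assert (I1 : 0 <= RInt g a c1) by (apply RInt_ge_0; [lra|apply Hi|intros; apply Hp; lra]).
assert (I3 : 0 <= RInt g c2 b) by (apply RInt_ge_0; [lra|apply Hi|intros; apply Hp; lra]).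
assert (I2 : 0 < RInt g c1 c2).
{ apply RInt_gt_0; [lra| |intros; apply Hc].
  intros t Ht. apply Hd. change (Rabs (t - x) < d). apply Rabs_def1; lra. }
lra.
Qed.

Lemma sph_amb (f : S2 -> R) th ph :
  f (sph th ph) = amb f (vec (sin th * cos ph) (sin th * sin ph) (cos th)).
Proof. unfold amb; symmetry; f_equal; apply (rproj_pt (sph th ph)). Qed.

Lemma sph_nonzero th ph : vec (sin th * cos ph) (sin th * sin ph) (cos th) <> zero.
Proof. apply (pt_nonzero (sph th ph)). Qed.

Lemma sinsq_sph th ph : sinsq (sph th ph) = sin th * sin th.
Proof. rewrite sinsq_eq. generalize (sin2_cos2 th); unfold Rsqr, pz; cbn; lra. Qed.

Lemma continuity_2d_sph (f : S2 -> R) th ph :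
  smooth f -> continuity_2d_pt (fun th ph => f (sph th ph)) th ph.
Proof.
intros Hf.
apply continuity_2d_pt_ext with
  (fun th ph => amb f (vec (sin th * cos ph) (sin th * sin ph) (cos th))).
{ intros; symmetry; apply sph_amb. }
apply continuity_2d_pt_filterlim.
apply (continuous_comp
  (fun z : R * R => vec (sin (fst z) * cos (snd z)) (sin (fst z) * sin (snd z)) (cos (fst z)))
  (amb f) (th, ph)).
2:{ apply (Ck_continuous 0); [apply Hf|apply sph_nonzero]. }
assert (C : forall (g : R -> R) (q : R * R -> R), (forall t, ex_derive g t) ->
  (forall z, continuous q z) -> forall z, continuous (fun z => g (q z)) z).
{ intros g q Hg Hq z. apply continuous_comp; [apply Hq|].
  apply (ex_derive_continuous (V := R_NormedModule)), Hg. }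
assert (C1 : forall t, ex_derive sin t) by (intros; now auto_derive).
assert (C2 : forall t, ex_derive cos t) by (intros; now auto_derive).
apply (continuous_vec (fun z : R * R => sin (fst z) * cos (snd z))
        (fun z => sin (fst z) * sin (snd z)) (fun z => cos (fst z))).
- apply (continuous_mult (K := R_AbsRing) (fun z : R * R => sin (fst z)) (fun z => cos (snd z)));
  apply C; trivial; intros [a b]; [apply continuous_fst|apply continuous_snd].
- apply (continuous_mult (K := R_AbsRing) (fun z : R * R => sin (fst z)) (fun z => sin (snd z)));
  apply C; trivial; intros [a b]; [apply continuous_fst|apply continuous_snd].
- apply C; trivial; intros [a b]; apply continuous_fst.
Qed.

Definition d_theta f th ph : R :=
  cos th * cos ph * dx f (sph th ph) + cos th * sin ph * dy f (sph th ph)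
  - sin th * dz f (sph th ph).

Lemma is_derive_th (f : S2 -> R) th ph : smooth f ->
  is_derive (fun t => f (sph t ph)) th (d_theta f th ph).
Proof.
intros Hf.
apply is_derive_ext with (fun t => amb f (vec (sin t * cos ph) (sin t * sin ph) (cos t))).
{ intros; symmetry; apply sph_amb. }
eapply is_derive_eq.
apply (is_derive_amb f (fun t => sin t * cos ph) (fun t => sin t * sin ph) cos
         (cos th * cos ph) (cos th * sin ph) (- sin th)); trivial.
- apply sph_nonzero.
- auto_derive; [trivial|ring].
- auto_derive; [trivial|ring].
- auto_derive; [trivial|ring].
- unfold d_theta, dx, dy, dz; rewrite !dS_dir; cbn [pt sph]. ring.
Qed.

Lemma is_derive_ph (f : S2 -> R) th ph : smooth f ->
  is_derive (fun t => f (sph th t)) ph (D2 f (sph th ph)).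
Proof.
intros Hf.
apply is_derive_ext with (fun t => amb f (vec (sin th * cos t) (sin th * sin t) (cos th))).
{ intros; symmetry; apply sph_amb. }
eapply is_derive_eq.
apply (is_derive_amb f (fun t => sin th * cos t) (fun t => sin th * sin t) (fun _ => cos th)
         (- (sin th * sin ph)) (sin th * cos ph) 0); trivial.
- apply sph_nonzero.
- auto_derive; [trivial|ring].
- auto_derive; [trivial|ring].
- auto_derive; [trivial|ring].
- rewrite D2_dxy by trivial. sph_unfold.
  unfold dx, dy, dz; rewrite !dS_dir; unfold px, py; cbn [pt sph cx cy vec fst snd]. ring.
Qed.

Lemma sin_d_theta f th ph : smooth f -> sin th * d_theta f th ph = D1 f (sph th ph).
Proof.
intros Hf. rewrite D1_dz by trivial. sph_unfold.
assert (T := dS_tangency f (sph th ph) Hf).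
fold (dx f (sph th ph)) (dy f (sph th ph)) (dz f (sph th ph)) in T.
assert (U := sinsq_sph th ph). rewrite sinsq_eq in U. 
unfold d_theta. unfold px, py, pz in T, U; cbn [pt sph cx cy cz vec fst snd] in T, U.
apply Rminus_diag_uniq.
transitivity (cos th * (sin th * cos ph * dx f (sph th ph) + sin th * sin ph * dy f (sph th ph)
  + cos th * dz f (sph th ph)) + (1 - cos th * cos th - sin th * sin th) * dz f (sph th ph));
  [ring|rewrite T, U; ring].
Qed.

Lemma continuity_2d_d_theta f th ph : smooth f -> continuity_2d_pt (d_theta f) th ph.
Proof.
intros Hf; unfold d_theta.
assert (S : forall t s, continuity_2d_pt (fun t s => sin t) t s).
{ intros; apply (continuity_1d_2d_pt_comp sin (fun t _ => t)).
  apply continuity_sin. apply continuity_2d_pt_id1. }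
assert (C : forall t s, continuity_2d_pt (fun t s => cos t) t s).
{ intros; apply (continuity_1d_2d_pt_comp cos (fun t _ => t)).
  apply continuity_cos. apply continuity_2d_pt_id1. }
assert (S' : forall t s, continuity_2d_pt (fun t s => sin s) t s).
{ intros; apply (continuity_1d_2d_pt_comp sin (fun _ s => s)).
  apply continuity_sin. apply continuity_2d_pt_id2. }
assert (C' : forall t s, continuity_2d_pt (fun t s => cos s) t s).
{ intros; apply (continuity_1d_2d_pt_comp cos (fun _ s => s)).
  apply continuity_cos. apply continuity_2d_pt_id2. }
apply continuity_2d_pt_minus; [apply continuity_2d_pt_plus|];
 repeat apply continuity_2d_pt_mult; trivial; apply continuity_2d_sph; smooth.
Qed.

Lemma continuous_2d_snd (g : R -> R -> R) t s :
  continuity_2d_pt g t s -> continuous (g t) s.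
Proof.
intros H. apply (continuous_comp_2 (fun _ => t) (fun s => s) g).
- apply continuous_const.
- apply continuous_id.
- now apply continuity_2d_pt_filterlim.
Qed.

Lemma sph_period th : sph th (2 * PI) = sph th 0.
Proof.
apply S2_ext; cbn. now rewrite cos_2PI, sin_2PI, cos_0, sin_0.
Qed.

(** The divergence theorem for the field whose inner products with [mer] and [rot] are [y]
    and [Y / sinsq]. The [rot] part integrates to zero over each parallel, by periodicity;
    the rest is the derivative of the integral of [y] over the parallel, which vanishes at
    both poles. *)
Lemma sphere_int_divergence f y Y :
  smooth y -> smooth Y -> (forall p, sinsq p = 0 -> y p = 0) ->
  (forall th ph, 0 < th < PI -> 0 < ph < 2 * PI -> let p := sph th ph in
     f p * (sinsq p * sinsq p) = sinsq p * D1 y p + D2 Y p) ->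
  sphere_int f = 0.
Proof.
intros Hy HY Hpole Hf. unfold sphere_int.
assert (Pi := PI_RGT_0).
set (H := fun th => RInt (fun ph => y (sph th ph)) 0 (2 * PI)).
assert (HI : forall g th, smooth g -> ex_RInt (fun ph => g (sph th ph)) 0 (2 * PI)).
{ intros g th Hg. apply (ex_RInt_continuous (V := R_CompleteNormedModule)); intros s _.
  now apply (continuous_2d_snd (fun th ph => g (sph th ph))), continuity_2d_sph. }
assert (Hth : forall th, ex_RInt (d_theta y th) 0 (2 * PI)).
{ intros th. apply (ex_RInt_continuous (V := R_CompleteNormedModule)); intros s _.
  now apply continuous_2d_snd, continuity_2d_d_theta. }
assert (HH : forall th, is_derive H th (RInt (d_theta y th) 0 (2 * PI))).
{ intros th. eapply is_derive_eq.
  - apply (is_derive_RInt_param (fun th ph => y (sph th ph))).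
    + apply filter_forall; intros t s _. eexists; now apply is_derive_th.
    + intros s _. apply continuity_2d_pt_ext with (d_theta y).
      * intros a b; symmetry; now apply is_derive_unique, is_derive_th.
      * now apply continuity_2d_d_theta.
    + apply filter_forall; intros t; now apply HI.
  - apply RInt_ext; intros s _; now apply is_derive_unique, is_derive_th. }
rewrite (RInt_ext _ (fun th => RInt (d_theta y th) 0 (2 * PI))).
- assert (E := is_RInt_derive (V := R_CompleteNormedModule) H _ 0 PI
    (fun th _ => HH th)
    (fun th _ => continuous_RInt_param (d_theta y) 0 (2 * PI) th ltac:(lra)
                  (fun t s => continuity_2d_d_theta y t s Hy))).
  rewrite (is_RInt_unique _ _ _ _ E).
  assert (H0 : forall th, sin th = 0 -> H th = 0).
  { intros th Hth0. unfold H. rewrite (RInt_ext _ (fun _ => 0)).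
    - rewrite RInt_const. unfold scal; cbn; unfold mult; cbn; ring.
    - intros s _; apply Hpole. rewrite sinsq_sph, Hth0; ring. }
  rewrite !H0 by (apply sin_0 || apply sin_PI). unfold minus, plus, opp; cbn; ring.
- rewrite Rmin_left, Rmax_right by lra. intros th Ht.
  assert (Hs := sin_gt_0 th (proj1 Ht) (proj2 Ht)).
  set (c := / (sin th * sin th * sin th)).
  rewrite (RInt_ext _ (fun ph => plus (d_theta y th ph) (scal c (D2 Y (sph th ph))))).
  + rewrite (RInt_plus (V := R_CompleteNormedModule) (d_theta y th)); [|apply Hth|].
    2:{ apply (ex_RInt_scal (V := R_CompleteNormedModule)), HI; smooth. }
    rewrite (RInt_scal (V := R_CompleteNormedModule)) by (apply HI; smooth).
    rewrite (is_RInt_unique (fun ph => D2 Y (sph th ph)) 0 (2 * PI) (minus (Y (sph th (2 * PI))) (Y (sph th 0)))).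
    * rewrite sph_period. unfold minus, plus, opp, scal; cbn; unfold mult; cbn; ring.
    * apply (is_RInt_derive (V := R_CompleteNormedModule) (fun ph => Y (sph th ph))).
      -- intros s _; now apply is_derive_ph.
      -- intros s _; apply (continuous_2d_snd (fun th ph => D2 Y (sph th ph))), continuity_2d_sph; smooth.
  + rewrite Rmin_left, Rmax_right by lra. intros ph Hph. assert (W := sinsq_sph th ph).
    specialize (Hf th ph Ht Hph). cbv zeta in Hf. rewrite W, <- sin_d_theta in Hf by trivial.
    unfold plus, scal; cbn; unfold mult; cbn. unfold c.
    assert (H3 : 0 < sin th * sin th * sin th) by (repeat apply Rmult_lt_0_compat; trivial).
    apply Rmult_eq_reg_r with (sin th * sin th * sin th); [|lra].
    replace (f (sph th ph) * sin th * _) with (f (sph th ph) * (sin th * sin th * (sin th * sin th))) by ring.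
    rewrite Hf; field; lra.
Qed.

Lemma sphere_int_nonneg_eq_0 (f : S2 -> R) th ph :
  smooth f -> (forall p, sinsq p <> 0 -> 0 <= f p) -> sphere_int f = 0 ->
  0 < th < PI -> 0 < ph < 2 * PI -> f (sph th ph) = 0.
Proof.
intros Hf Hp HI Ht Hph.
set (g := fun th ph => f (sph th ph) * sin th).
assert (Cg : forall t s, continuity_2d_pt g t s).
{ intros t s; apply continuity_2d_pt_mult; [now apply continuity_2d_sph|].
  apply (continuity_1d_2d_pt_comp sin (fun t _ => t)).
  apply continuity_sin. apply continuity_2d_pt_id1. }
assert (Pg : forall t s, 0 <= t <= PI -> 0 <= g t s).
{ intros t s Hts. assert (S := sin_ge_0 t (proj1 Hts) (proj2 Hts)). unfold g.
  destruct S as [S|S]; [|rewrite <- S; lra].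
  apply Rmult_le_pos; [|lra]. apply Hp. rewrite sinsq_sph; nra. }
assert (Ig : forall t, ex_RInt (g t) 0 (2 * PI)).
{ intros t; apply (ex_RInt_continuous (V := R_CompleteNormedModule)); intros s _.
  now apply continuous_2d_snd. }
assert (Pi := PI_RGT_0).
assert (E : RInt (g th) 0 (2 * PI) = 0).
{ apply (RInt_nonneg_eq_0 (fun t => RInt (g t) 0 (2 * PI)) 0 PI th); trivial.
  - intros t; apply continuous_RInt_param; trivial; lra.
  - intros t Hts; apply RInt_ge_0; [lra|apply Ig|]. intros; now apply Pg. }
assert (E' : g th ph = 0).
{ apply (RInt_nonneg_eq_0 (g th) 0 (2 * PI) ph); trivial.
  - intros s; now apply continuous_2d_snd.
  - intros s _; apply Pg; lra. }
assert (S := sin_gt_0 th (proj1 Ht) (proj2 Ht)).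
unfold g in E'. apply Rmult_integral in E'. destruct E'; [trivial|lra].
Qed.

(** * Conformal Killing fields *)

Definition compx (X : S2 -> R3) : S2 -> R := fun p => cx (X p).
Definition compy (X : S2 -> R3) : S2 -> R := fun p => cy (X p).
Definition compz (X : S2 -> R3) : S2 -> R := fun p => cz (X p).

(** [sinsq] times the components of [X] along [mer] and [rot]. *)
Definition mcomp (X : S2 -> R3) : S2 -> R := (#(-1) * compz X)%sph.
Definition rcomp (X : S2 -> R3) : S2 -> R := (px * compy X - py * compx X)%sph.
Definition divergence (X : S2 -> R3) : S2 -> R := (dx (compx X) + dy (compy X) + dz (compz X))%sph.

Lemma vf_tangency X : is_vector_field X ->
  (px * compx X + py * compy X + pz * compz X)%sph = #0%sph.
Proof. intros [T _]; sph_ext p. exact (T p). Qed.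

(** Expansion of [X] in the frame; the factor [sinsq] makes it valid at the poles. *)
Lemma sinsq_lieD X f : is_vector_field X -> smooth f ->
  (sinsq * lieD X f = mcomp X * D1 f + rcomp X * D2 f)%sph.
Proof.
intros HX Hf.
assert (S := vf_tangency X HX).
rewrite D1_dz, D2_dxy by trivial. sph_ext p. at_point S p.
unfold lieD. rewrite (dS_linear f p (X p)) by trivial.
fold (dx f p) (dy f p) (dz f p) (compx X p) (compy X p) (compz X p).
assert (T := dS_tangency f p Hf). fold (dx f p) (dy f p) (dz f p) in T.
assert (U := unit_coord p).
assert (T' : px p * dx f p + py p * dy f p = - (pz p * dz f p)) by lra.
assert (S' : px p * compx X p + py p * compy X p = - (pz p * compz X p)) by lra.
unfold sinsq, mcomp, rcomp; sph_unfold.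
transitivity ((px p * dx f p + py p * dy f p) * (px p * compx X p + py p * compy X p)
  + (px p * dy f p - py p * dx f p) * (px p * compy X p - py p * compx X p)
  + (1 - pz p * pz p) * dz f p * compz X p).
- rewrite <- U; ring.
- rewrite T', S'; ring.
Qed.

Lemma dot_comm x y : dot x y = dot y x.
Proof. unfold dot; ring. Qed.

(** The tangential projection in [nabla] is invisible to tangent vectors. *)
Lemma dot_nabla v Y p z : dot (pt p) z = 0 ->
  dot (nabla v Y p) z = cx z * dS (compx Y) p v + cy z * dS (compy Y) p v + cz z * dS (compz Y) p v.
Proof.
intros Hz. unfold nabla, tproj.
fold (compx Y) (compy Y) (compz Y).
set (V := vec _ _ _).
change (dot (line V (pt p) (- dot (pt p) V)) z = 
  cx z * dS (compx Y) p v + cy z * dS (compy Y) p v + cz z * dS (compz Y) p v).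
generalize (- dot (pt p) V); intros k.
rewrite line_vec; unfold V, dot in *; cbn [cx cy cz vec fst snd].
transitivity (cx z * dS (compx Y) p v + cy z * dS (compy Y) p v + cz z * dS (compz Y) p v
  + k * (cx (pt p) * cx z + cy (pt p) * cy z + cz (pt p) * cz z)); [ring|rewrite Hz; ring].
Qed.

(** The Cauchy-Riemann equations for [a / sinsq] and [b / sinsq], the components of a
    conformal field of divergence [l] in the isothermal Mercator coordinates. *)
Record conformal_components (a b l : S2 -> R) : Prop := {
  cc_a : smooth a;
  cc_b : smooth b;
  cc_l : smooth l;
  cc_D1a : (D1 a = #(1/2) * sinsq * l + pz * a)%sph;
  cc_D2b : (D2 b = #(1/2) * sinsq * l - pz * a)%sph;
  cc_D1b : (D1 b = #2 * pz * b - D2 a)%sph }.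

(** The three equations are [L_X g = lam g] evaluated on the pairs (mer, mer), (rot, rot)
    and (mer, rot); comparing traces identifies [lam] with the divergence. *)
Lemma conformal_killing_components X : conformal_killing X ->
  conformal_components (mcomp X) (rcomp X) (divergence X).
Proof.
intros [HX [lam Hlam]].
assert (T := vf_tangency X HX).
destruct HX as [_ [Hx [Hy Hz]]].
change (smooth (compx X)) in Hx; change (smooth (compy X)) in Hy; change (smooth (compz X)) in Hz.
assert (Hl : smooth (divergence X)) by (unfold divergence; smooth).
assert (T1 := f_equal D1 T). assert (T2 := f_equal D2 T).
derive_in T1; derive_in T2.
assert (EX := sinsq_dx (compx X) Hx). assert (EY := sinsq_dy (compy X) Hy).
assert (EZ := dz_D1 (compz X) Hz).

assert (K : forall p v v', dot (pt p) v = 0 -> dot (pt p) v' = 0 ->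
   cx v' * dS (compx X) p v + cy v' * dS (compy X) p v + cz v' * dS (compz X) p v
   + (cx v * dS (compx X) p v' + cy v * dS (compy X) p v' + cz v * dS (compz X) p v')
   = lam p * dot v v').
{ intros p v v' Hv Hv'. rewrite <- (Hlam p v v' Hv Hv'), (dot_comm v), !dot_nabla; trivial. }
assert (K11 : forall p, 2 * (pz p * px p * D1 (compx X) p + pz p * py p * D1 (compy X) p
     - sinsq p * D1 (compz X) p) = lam p * sinsq p).
{ intros p. specialize (K p (mer p) (mer p) (dot_mer p) (dot_mer p)).
  rewrite dot_mer_mer in K; rewrite <- K. unfold D1, lieD. cbn [mer cx cy cz vec fst snd]. ring. }
assert (K22 : forall p, 2 * (px p * D2 (compy X) p - py p * D2 (compx X) p) = lam p * sinsq p).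
{ intros p. specialize (K p (rot p) (rot p) (dot_rot p) (dot_rot p)).
  rewrite dot_rot_rot in K; rewrite <- K. unfold D2, lieD. cbn [rot cx cy cz vec fst snd]. ring. }
assert (K12 : forall p, px p * D1 (compy X) p - py p * D1 (compx X) p
   + (pz p * px p * D2 (compx X) p + pz p * py p * D2 (compy X) p
      - sinsq p * D2 (compz X) p) = 0).
{ intros p. specialize (K p (mer p) (rot p) (dot_mer p) (dot_rot p)).
  rewrite dot_mer_rot, Rmult_0_r in K; rewrite <- K.
  unfold D1, D2, lieD. cbn [mer rot cx cy cz vec fst snd]. ring. }
clear K Hlam.
assert (E : forall p, sinsq p * divergence X p =
  px p * pz p * D1 (compx X) p - py p * D2 (compx X) p
  + (py p * pz p * D1 (compy X) p + px p * D2 (compy X) p) - sinsq p * D1 (compz X) p).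
{ intros p. at_point EX p; at_point EY p; at_point EZ p. unfold divergence; sph_unfold.
  rewrite !Rmult_plus_distr_l, EX, EY, EZ; ring. }
assert (Ha : smooth (mcomp X)) by (unfold mcomp; smooth).
assert (Hb : smooth (rcomp X)) by (unfold rcomp; smooth).
assert (P : forall p, px p * D1 (compx X) p + py p * D1 (compy X) p
      = compz X p - pz p * D1 (compz X) p).
{ intros p. at_point T1 p; at_point T p. assert (W := sinsq_eq p). 
  apply (f_equal (Rmult (pz p))) in T. rewrite W in T1. lra. }
split; trivial; unfold mcomp, rcomp; derive; apply functional_extensionality; intros p; sph_unfold;
specialize (K11 p); specialize (K22 p); specialize (K12 p); specialize (P p);
assert (W := sinsq_eq p); at_point T p; at_point T2 p;
assert (PP := f_equal (Rmult (pz p)) P); assert (TT := f_equal (Rmult (pz p)) T);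
assert (TT2 := f_equal (Rmult (pz p)) T2); rewrite ?(Rmult_assoc (1 / 2)), ?E;
rewrite W in K11, K22, K12; rewrite ?W; lra.
Qed.

#[export] Hint Resolve cc_a cc_b cc_l : smooth.

(** From [D1 (D2 b) = D2 (D1 b)]. *)
Lemma conformal_D22a a b l : conformal_components a b l ->
  D2 (D2 a) = (#(1/2) * pz * sinsq * l - #(1/2) * sinsq * D1 l - a)%sph.
Proof.
intros [Ha Hb Hl A1 B2 B1].
assert (E1 := f_equal D2 B1). assert (E2 := f_equal D1 B2).
derive_in E1; derive_in E2. sph_ext p.
at_point E1 p; at_point E2 p; at_point A1 p; at_point B2 p.
assert (W := sinsq_eq p). rewrite W in *.
rewrite E2, B2, A1 in E1. lra.
Qed.

(** The integrability condition [D1 (D2 (D2 a)) = D2 (D2 (D1 a))]: the divergence is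
    an eigenfunction of the Laplacian. *)
Lemma conformal_laplace a b l : conformal_components a b l ->
  (D1 (D1 l) + D2 (D2 l) = #(-2) * sinsq * l)%sph.
Proof.
intros H. assert (A22 := conformal_D22a a b l H). destruct H as [Ha Hb Hl A1 B2 B1].
assert (E1 := f_equal D1 A22). assert (E2 := f_equal D2 (f_equal D2 A1)).
derive_in E1; derive_in E2.
apply sinsq_cancel; [smooth..|]. sph_ext p.
at_point E1 p; at_point E2 p; at_point A1 p; at_point A22 p.
rewrite E2, A22, A1 in E1.
assert (W := sinsq_eq p).
rewrite W in E1 |- *. lra.
Qed.

(** The entries of [Hess l + l g] on (mer, mer) and (mer, rot); when [Lap l = - 2 l] the
    tensor is trace free, so these two determine it. *)
Definition q11 l : S2 -> R := (D1 (D1 l) - pz * D1 l + sinsq * l)%sph.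
Definition q12 l : S2 -> R := (D2 (D1 l) - pz * D2 l)%sph.

Definition energy l : S2 -> R := (#(1/2) * (ginner l l + l * l))%sph.

Lemma solve_plus a t c : a + t = c -> t = c - a.
Proof. intros <-; ring. Qed.

(** Bochner's formula gives [Lap (|grad l|^2) / 2 = |Hess l|^2 - |grad l|^2] when
    [Lap l = - 2 l], and adding [Lap (l^2) / 2] completes the square [|Hess l + l g|^2]. *)
Lemma bochner l p : smooth l ->
  (D1 (D1 l) + D2 (D2 l) = #(-2) * sinsq * l)%sph -> sinsq p <> 0 ->
  Lap (energy l) p = 2 * (q11 l p ^ 2 + q12 l p ^ 2) / sinsq p ^ 2.
Proof.
intros Hl L Hp.
assert (HE : smooth (energy l)) by (unfold energy; smooth).
assert (EL := sinsq_Lap _ HE). assert (EG := sinsq_ginner l l Hl Hl).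
unfold energy in EL at 2 3; derive_in EL.
assert (EG1 := f_equal D1 EG). assert (EG11 := f_equal D1 EG1).
assert (EG2 := f_equal D2 EG). assert (EG22 := f_equal D2 EG2).
assert (L1 := f_equal D1 L). assert (L2 := f_equal D2 L).
derive_in EG1; derive_in EG11; derive_in EG2; derive_in EG22; derive_in L1; derive_in L2.
at_point EL p; at_point EG p; at_point EG1 p; at_point EG11 p; at_point EG2 p; at_point EG22 p.
at_point L p; at_point L1 p; at_point L2 p.
apply solve0 in EL, EG; trivial. apply solve1 in EG1, EG2; trivial.
apply solve2 in EG11, EG22; trivial.
apply solve_plus in L, L1, L2.
rewrite EL, EG11, EG22, EG1, EG2, EG, L1, L2, L. unfold q11, q12; sph_unfold.
assert (Z : pz p ^ 2 = 1 - sinsq p) by (rewrite sinsq_eq; ring).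
field_simplify_eq; [|easy]. ring [Z].
Qed.

(** The trace-free Hessian of the divergence vanishes: its square is a Laplacian, and
    the integral of a Laplacian is zero. *)
Lemma conformal_divergence_hessian a b l th ph :
  conformal_components a b l -> 0 < th < PI -> 0 < ph < 2 * PI ->
  q11 l (sph th ph) = 0 /\ q12 l (sph th ph) = 0.
Proof.
intros H Hth Hph.
assert (L := conformal_laplace a b l H). destruct H as [_ _ Hl _ _ _].
assert (HE : smooth (energy l)) by (unfold energy; smooth).
assert (N : sinsq (sph th ph) <> 0).
{ rewrite sinsq_sph. assert (S := sin_gt_0 th (proj1 Hth) (proj2 Hth)). nra. }
assert (E : Lap (energy l) (sph th ph) = 0).
{ apply sphere_int_nonneg_eq_0; trivial; [smooth| |].
  - intros p Hp. rewrite bochner by trivial.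
    assert (S := sinsq_pos p Hp).
    apply Rmult_le_pos; [nra|]. left; apply Rinv_0_lt_compat; nra.
  - apply sphere_int_divergence with (D1 (energy l)) (sinsq * D2 (energy l))%sph; [smooth..| |].
    + intros p Hp; now apply D1_pole.
    + intros t s _ _ p. assert (EL := sinsq_Lap _ HE). derive. at_point EL p; sph_unfold.
      transitivity (sinsq p * (sinsq p * Lap (energy l) p)); [ring|rewrite EL; ring]. }
rewrite bochner in E by trivial. assert (S := sinsq_pos _ N).
set (a1 := q11 _ _) in *; set (a2 := q12 _ _) in *.
assert (F : 2 * (a1 ^ 2 + a2 ^ 2) = 0).
{ apply Rmult_integral in E; destruct E as [E|E]; trivial.
  assert (0 < / sinsq (sph th ph) ^ 2) by (apply Rinv_0_lt_compat; nra). lra. }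
split; nra.
Qed.

(** * The eigenvalues of [g_u^{-1} A] *)

(** The coefficients of [A] on (mer, mer), (mer, rot) and (rot, rot); see
    [A_tensor_comb]. *)
Definition A11 u : S2 -> R :=
  (#(-1) * (D1 (D1 u) - pz * D1 u) + #(1/4) * (D1 u * D1 u - D2 u * D2 u) + sinsq)%sph.
Definition A12 u : S2 -> R :=
  (#(-1) * (D2 (D1 u) - pz * D2 u) + #(1/2) * (D1 u * D2 u))%sph.
Definition A22 u : S2 -> R :=
  (#(-1) * (D2 (D2 u) + pz * D1 u) + #(1/4) * (D2 u * D2 u - D1 u * D1 u) + sinsq)%sph.

Definition comb (s t : R) (p : S2) : R3 := plus (scal s (mer p)) (scal t (rot p)).

Lemma comb_vec s t p : comb s t p =
  vec (s * (pz p * px p) + t * - py p) (s * (pz p * py p) + t * px p) (s * - sinsq p).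
Proof.
unfold comb; rewrite !scal_vec. apply R3_ext; cbn; unfold plus; cbn; ring.
Qed.

Lemma dS_comb f p s t : smooth f -> dS f p (comb s t p) = s * D1 f p + t * D2 f p.
Proof.
intros Hf. unfold D1, D2, lieD.
rewrite (dS_linear f p (comb s t p)), (dS_linear f p (mer p)), (dS_linear f p (rot p)) by trivial.
rewrite comb_vec; unfold mer, rot; cbn [cx cy cz vec fst snd]; ring.
Qed.

Lemma dot_comb_l s t p z : dot (comb s t p) z = s * dot (mer p) z + t * dot (rot p) z.
Proof. rewrite comb_vec; unfold dot, mer, rot; cbn [cx cy cz vec fst snd]; ring. Qed.

Lemma dot_comb_r s t p z : dot z (comb s t p) = s * dot z (mer p) + t * dot z (rot p).
Proof. rewrite comb_vec; unfold dot, mer, rot; cbn [cx cy cz vec fst snd]; ring. Qed.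

Lemma tangent_comb s t p : tangent p (comb s t p).
Proof. unfold tangent; rewrite dot_comb_r, dot_mer, dot_rot; ring. Qed.

Lemma tangent_is_comb p e : sinsq p <> 0 -> tangent p e ->
  e = comb (dot (mer p) e / sinsq p) (dot (rot p) e / sinsq p) p.
Proof.
intros Hp He. unfold tangent in He.
assert (U := unit_coord p).
assert (M : dot (mer p) e = - cz e).
{ unfold dot, mer in *; cbn [cx cy cz vec fst snd] in *. fold (px p) (py p) (pz p) in He.
  apply (f_equal (Rmult (pz p))) in He. rewrite sinsq_eq. lra. }
rewrite M, comb_vec. unfold dot, rot in *; cbn [cx cy cz vec fst snd] in *.
fold (px p) (py p) (pz p) in He.
assert (Z : pz p * cz e = - (px p * cx e + py p * cy e)) by lra.
apply R3_ext; cbn [cx cy cz vec fst snd]; apply Rmult_eq_reg_l with (sinsq p); trivial.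
- transitivity (- (pz p * cz e) * px p - (px p * cy e - py p * cx e) * py p);
  [rewrite Z; unfold sinsq; sph_unfold; ring|field; trivial].
- transitivity (- (pz p * cz e) * py p + (px p * cy e - py p * cx e) * px p);
  [rewrite Z; unfold sinsq; sph_unfold; ring|field; trivial].
- field; trivial.
Qed.

Lemma D1_mer u : smooth u -> D1 u = (pz * px * dx u + pz * py * dy u - sinsq * dz u)%sph.
Proof.
intros Hu; sph_ext p. unfold D1, lieD. rewrite (dS_linear u p (mer p)) by trivial.
unfold mer; cbn [cx cy cz vec fst snd]; unfold dx, dy, dz; ring.
Qed.

(** The Hessian in the Mercator frame; the terms with [pz] are Christoffel symbols. *)
Lemma hess_comb u p s t : smooth u ->
  hess u p (comb s t p) (mer p)
    = s * (D1 (D1 u) p - pz p * D1 u p) + t * (D2 (D1 u) p - pz p * D2 u p) /\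
  hess u p (comb s t p) (rot p)
    = s * (D2 (D1 u) p - pz p * D2 u p) + t * (D2 (D2 u) p + pz p * D1 u p).
Proof.
intros Hu. unfold hess. rewrite !dot_nabla by (apply dot_mer || apply dot_rot).
change (compx (grad u)) with (dx u); change (compy (grad u)) with (dy u);
change (compz (grad u)) with (dz u).
rewrite !dS_comb by smooth. unfold mer, rot; cbn [cx cy cz vec fst snd].
assert (E1 := D1_mer u Hu). assert (E2 := D2_dxy u Hu).
assert (E11 := f_equal D1 E1). assert (E12 := f_equal D2 E1).
assert (E21 := f_equal D1 E2). assert (E22 := f_equal D2 E2).
derive_in E11; derive_in E12; derive_in E21; derive_in E22.
assert (T := dS_tangency u p Hu). fold (dx u p) (dy u p) (dz u p) in T.
at_point E1 p; at_point E2 p; at_point E11 p; at_point E12 p; at_point E21 p; at_point E22 p.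
assert (Z := dz_D1 u Hu); at_point Z p.
assert (W := sinsq_eq p).
assert (T1 := f_equal (Rmult (pz p * pz p - sinsq p)) T).
assert (T2 := f_equal (Rmult (pz p)) E2). assert (Z1 := f_equal (Rmult (pz p)) Z).
assert (Z2 := f_equal (Rmult (pz p * (pz p * pz p - sinsq p))) Z).
assert (H11 : pz p * px p * D1 (dx u) p + pz p * py p * D1 (dy u) p - sinsq p * D1 (dz u) p
   = D1 (D1 u) p - pz p * D1 u p) by (rewrite W in *; lra).
assert (H12 : pz p * px p * D2 (dx u) p + pz p * py p * D2 (dy u) p - sinsq p * D2 (dz u) p
   = D2 (D1 u) p - pz p * D2 u p) by (rewrite W in *; lra).
assert (H21 : - py p * D1 (dx u) p + px p * D1 (dy u) p = D2 (D1 u) p - pz p * D2 u p) by lra.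
assert (H22 : - py p * D2 (dx u) p + px p * D2 (dy u) p = D2 (D2 u) p + pz p * D1 u p) by lra.
split; [rewrite <- H11, <- H12|rewrite <- H21, <- H22]; ring.
Qed.

Lemma A_tensor_comb u p s t : smooth u ->
  A_tensor u p (comb s t p) (mer p) = s * A11 u p + t * A12 u p /\
  A_tensor u p (comb s t p) (rot p) = s * A12 u p + t * A22 u p.
Proof.
intros Hu. destruct (hess_comb u p s t Hu) as [H1 H2].
assert (EG := sinsq_ginner u u Hu Hu); at_point EG p.
assert (E : dot (grad u p) (grad u p) = ginner u u p) by reflexivity.
unfold A_tensor, gauss_curv.
rewrite H1, H2, E, !dot_comb_l, dot_mer_mer, dot_rot_rot, dot_mer_rot, (dot_comm (rot p)), dot_mer_rot, !dS_comb by trivial.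
change (dS u p (mer p)) with (D1 u p). change (dS u p (rot p)) with (D2 u p).
unfold A11, A12, A22; sph_unfold.
split.
- transitivity (s * (- (D1 (D1 u) p - pz p * D1 u p) + 1 / 2 * (D1 u p * D1 u p)
    - 1 / 4 * (sinsq p * ginner u u p) + sinsq p)
    + t * (- (D2 (D1 u) p - pz p * D2 u p) + 1 / 2 * (D1 u p * D2 u p)));
  [field|rewrite EG; field].
- transitivity (t * (- (D2 (D2 u) p + pz p * D1 u p) + 1 / 2 * (D2 u p * D2 u p)
    - 1 / 4 * (sinsq p * ginner u u p) + sinsq p)
    + s * (- (D2 (D1 u) p - pz p * D2 u p) + 1 / 2 * (D1 u p * D2 u p)));
  [field|rewrite EG; field].
Qed.

(** It suffices to test the eigenvector equation against [mer] and [rot], which span the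
    tangent plane. *)
Lemma eigenpair_comb u p l s t : smooth u -> sinsq p <> 0 ->
  let k := exp (u p) * sinsq p in
  eigenpair u p l (comb s t p) <->
  s * A11 u p + t * A12 u p = l * (k * s) /\ s * A12 u p + t * A22 u p = l * (k * t).
Proof.
intros Hu Hp k. destruct (A_tensor_comb u p s t Hu) as [H1 H2].
assert (C1 : conf_metric u p (comb s t p) (mer p) = k * s).
{ unfold conf_metric; rewrite dot_comb_l, dot_mer_mer, (dot_comm (rot p)), dot_mer_rot; unfold k; ring. }
assert (C2 : conf_metric u p (comb s t p) (rot p) = k * t).
{ unfold conf_metric; rewrite dot_comb_l, dot_rot_rot, dot_mer_rot; unfold k; ring. }
split.
- intros [_ H]. rewrite <- H1, <- H2, <- C1, <- C2.
  split; apply H; [apply dot_mer|apply dot_rot].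
- intros [E1 E2]; split; [apply tangent_comb|]. intros z Hz.
  rewrite (tangent_is_comb p z Hp Hz).
  set (s' := dot (mer p) z / _). set (t' := dot (rot p) z / _).
  rewrite <- C1, <- H1 in E1. rewrite <- C2, <- H2 in E2.
  transitivity (s' * A_tensor u p (comb s t p) (mer p) + t' * A_tensor u p (comb s t p) (rot p)).
  + unfold A_tensor, hess. rewrite !dot_comb_r, (dS_comb u p s' t') by trivial.
    unfold D1, D2, lieD; ring.
  + rewrite E1, E2. unfold conf_metric; rewrite !dot_comb_r; ring.
Qed.

Lemma lin_indep_comb p s1 t1 s2 t2 : sinsq p <> 0 ->
  lin_indep (comb s1 t1 p) (comb s2 t2 p) <-> s1 * t2 - s2 * t1 <> 0.
Proof.
intros Hp.
assert (C : forall a b, plus (scal a (comb s1 t1 p)) (scal b (comb s2 t2 p))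
                        = comb (a * s1 + b * s2) (a * t1 + b * t2) p).
{ intros a b. rewrite !comb_vec, !scal_vec; apply R3_ext; cbn; unfold plus; cbn; ring. }
assert (C0 : comb 0 0 p = zero).
{ rewrite comb_vec; apply R3_ext; cbn; ring. }
split.
- intros H D.
  assert (K1 : t2 = 0 /\ - t1 = 0).
  { apply H; rewrite C; etransitivity; [|exact C0]. f_equal; lra. }
  assert (K2 : s2 = 0 /\ - s1 = 0).
  { apply H; rewrite C; etransitivity; [|exact C0]. f_equal; lra. }
  destruct (H 1 0) as [N _]; [|lra].
  rewrite C; etransitivity; [|exact C0]; f_equal; lra.
- intros D a b E. rewrite C in E.
  assert (E1 : dot (mer p) (comb (a * s1 + b * s2) (a * t1 + b * t2) p) = 0)
    by (rewrite E; unfold dot; cbn; ring).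
  assert (E2 : dot (rot p) (comb (a * s1 + b * s2) (a * t1 + b * t2) p) = 0)
    by (rewrite E; unfold dot; cbn; ring).
  rewrite dot_comb_r, dot_mer_mer, dot_mer_rot in E1.
  rewrite dot_comb_r, dot_rot_rot, dot_comm, dot_mer_rot in E2.
  assert (F1 : a * s1 + b * s2 = 0) by (apply Rmult_eq_reg_r with (sinsq p); [lra|trivial]).
  assert (F2 : a * t1 + b * t2 = 0) by (apply Rmult_eq_reg_r with (sinsq p); [lra|trivial]).
  split; apply Rmult_eq_reg_r with (s1 * t2 - s2 * t1); trivial.
  + transitivity ((a * s1 + b * s2) * t2 - (a * t1 + b * t2) * s2); [ring|rewrite F1, F2; ring].
  + transitivity ((a * t1 + b * t2) * s1 - (a * s1 + b * s2) * t1); [ring|rewrite F1, F2; ring].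
Qed.

(** When [m12 <> 0] the discriminant is positive, so the two eigenvalues differ and their
    eigenvectors are independent. *)
Lemma symmetric_eigenbasis (m11 m12 m22 : R) :
  exists l1 l2 s1 t1 s2 t2,
   s1 * t2 - s2 * t1 <> 0 /\
   (s1 * m11 + t1 * m12 = l1 * s1 /\ s1 * m12 + t1 * m22 = l1 * t1) /\
   (s2 * m11 + t2 * m12 = l2 * s2 /\ s2 * m12 + t2 * m22 = l2 * t2).
Proof.
destruct (Req_dec m12 0) as [E|E].
- exists m11, m22, 1, 0, 0, 1. rewrite E. repeat split; lra.
- set (d := (m11 - m22) ^ 2 + 4 * m12 ^ 2).
  assert (Hd : 0 < d) by (unfold d; generalize (pow2_gt_0 m12 E) (pow2_ge_0 (m11 - m22)); lra).
  assert (Hr := sqrt_lt_R0 d Hd). assert (Hq := sqrt_sqrt d ltac:(lra)).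
  set (r := sqrt d) in *. unfold d in Hq.
  exists ((m11 + m22 + r) / 2), ((m11 + m22 - r) / 2),
    m12, ((m22 - m11 + r) / 2), m12, ((m22 - m11 - r) / 2).
  repeat split; try nra.
Qed.

(** Both eigenvalues come from the matrix of [g_u^{-1} A] in the frame, so their product
    is its determinant, whatever the eigenbasis. *)
Lemma sigma2_eq u p : smooth u -> sinsq p <> 0 ->
  sigma2 u p = (A11 u p * A22 u p - A12 u p * A12 u p) / (exp (u p) * sinsq p) ^ 2.
Proof.
intros Hu Hp. set (k := exp (u p) * sinsq p).
assert (Hk : 0 < k) by (apply Rmult_lt_0_compat; [apply exp_pos|now apply sinsq_pos]).
set (P := fun s : R => exists (l1 l2 : R) (e1 e2 : R3),
    lin_indep e1 e2 /\ eigenpair u p l1 e1 /\ eigenpair u p l2 e2 /\ s = l1 * l2).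
assert (U : forall s, P s -> s = (A11 u p * A22 u p - A12 u p * A12 u p) / k ^ 2).
{ intros s (l1 & l2 & e1 & e2 & Hi & He1 & He2 & ->).
  assert (C1 := tangent_is_comb p e1 Hp (proj1 He1)).
  assert (C2 := tangent_is_comb p e2 Hp (proj1 He2)).
  rewrite C1 in He1, Hi. rewrite C2 in He2, Hi.
  revert He1 He2 Hi.
  generalize (dot (mer p) e1 / sinsq p) (dot (rot p) e1 / sinsq p)
    (dot (mer p) e2 / sinsq p) (dot (rot p) e2 / sinsq p).
  intros s1 t1 s2 t2 He1 He2 Hi.
  apply lin_indep_comb in Hi; trivial.
  apply eigenpair_comb in He1, He2; trivial. fold k in He1, He2.
  destruct He1 as [E1 F1], He2 as [E2 F2].
  apply Rmult_eq_reg_r with (k ^ 2 * (s1 * t2 - s2 * t1)).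
  2:{ apply Rmult_integral_contrapositive; split; [nra|trivial]. }
  transitivity ((l1 * (k * s1)) * (l2 * (k * t2)) - (l2 * (k * s2)) * (l1 * (k * t1))); [ring|].
  rewrite <- E1, <- F1, <- E2, <- F2. field; lra. }
apply U, (iota_correct P).
destruct (symmetric_eigenbasis (A11 u p / k) (A12 u p / k) (A22 u p / k))
  as (l1 & l2 & s1 & t1 & s2 & t2 & D & [E1 F1] & [E2 F2]).
assert (HP : P (l1 * l2)).
{ exists l1, l2, (comb s1 t1 p), (comb s2 t2 p).
  split; [now apply lin_indep_comb|]. split; [|split; [|reflexivity]].
  - apply eigenpair_comb; trivial; fold k; split; apply Rmult_eq_reg_r with (/ k);
    try (apply Rinv_neq_0_compat; lra).
    + replace (l1 * (k * s1) * / k) with (l1 * s1) by (field; lra). rewrite <- E1; field; lra.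
    + replace (l1 * (k * t1) * / k) with (l1 * t1) by (field; lra). rewrite <- F1; field; lra.
  - apply eigenpair_comb; trivial; fold k; split; apply Rmult_eq_reg_r with (/ k);
    try (apply Rinv_neq_0_compat; lra).
    + replace (l2 * (k * s2) * / k) with (l2 * s2) by (field; lra). rewrite <- E2; field; lra.
    + replace (l2 * (k * t2) * / k) with (l2 * t2) by (field; lra). rewrite <- F2; field; lra. }
exists (l1 * l2); split; [trivial|].
intros s Hs. rewrite (U _ Hs). now apply U.
Qed.

(** * The Newton tensor *)

Lemma smooth_A11 u : smooth u -> smooth (A11 u).
Proof. intros; unfold A11; smooth. Qed.
Lemma smooth_A12 u : smooth u -> smooth (A12 u).
Proof. intros; unfold A12; smooth. Qed.
Lemma smooth_A22 u : smooth u -> smooth (A22 u).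
Proof. intros; unfold A22; smooth. Qed.
#[export] Hint Resolve smooth_A11 smooth_A12 smooth_A22 : smooth.

Lemma D1_A11 u p : smooth u -> D1 (A11 u) p =
  - D1 (D1 (D1 u)) p + pz p * D1 (D1 u) p - sinsq p * D1 u p
  + (D1 u p * D1 (D1 u) p - D2 u p * D2 (D1 u) p) / 2 + 2 * pz p * sinsq p.
Proof. intros Hu; unfold A11; derive; sph_unfold; field. Qed.

Lemma D2_A11 u p : smooth u -> D2 (A11 u) p =
  - D2 (D1 (D1 u)) p + pz p * D2 (D1 u) p
  + (D1 u p * D2 (D1 u) p - D2 u p * D2 (D2 u) p) / 2.
Proof. intros Hu; unfold A11; derive; sph_unfold; field. Qed.

Lemma D1_A12 u p : smooth u -> D1 (A12 u) p =
  - D2 (D1 (D1 u)) p + pz p * D2 (D1 u) p - sinsq p * D2 u p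
  + (D1 (D1 u) p * D2 u p + D1 u p * D2 (D1 u) p) / 2.
Proof. intros Hu; unfold A12; derive; sph_unfold; field. Qed.

Lemma D2_A12 u p : smooth u -> D2 (A12 u) p =
  - D2 (D2 (D1 u)) p + pz p * D2 (D2 u) p
  + (D2 (D1 u) p * D2 u p + D1 u p * D2 (D2 u) p) / 2.
Proof. intros Hu; unfold A12; derive; sph_unfold; field. Qed.

Lemma D1_A22 u p : smooth u -> D1 (A22 u) p =
  - D2 (D2 (D1 u)) p - pz p * D1 (D1 u) p + sinsq p * D1 u p
  + (D2 u p * D2 (D1 u) p - D1 u p * D1 (D1 u) p) / 2 + 2 * pz p * sinsq p.
Proof. intros Hu; unfold A22; derive; sph_unfold; field. Qed.

Lemma D2_A22 u p : smooth u -> D2 (A22 u) p =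
  - D2 (D2 (D2 u)) p - pz p * D2 (D1 u) p
  + (D2 u p * D2 (D2 u) p - D1 u p * D2 (D1 u) p) / 2.
Proof. intros Hu; unfold A22; derive; sph_unfold; field. Qed.

Definition detA u : S2 -> R := (A11 u * A22 u - A12 u * A12 u)%sph.

(** With [k = X(u)] and [v = l + k], the pair [N], [M] is, up to the conformal factor, the
    field [T grad v]; the identity says that its divergence with respect to [g_u] is
    [- X(sigma_2) - 2 v sigma_2]. The hypotheses on [q11], [q12] and [conformal_laplace]
    eliminate all second derivatives of [l]. *)
Lemma newton_divergence a b l u k p :
  conformal_components a b l -> smooth u -> smooth k ->
  (sinsq * k = a * D1 u + b * D2 u)%sph ->
  sinsq p <> 0 -> q11 l p = 0 -> q12 l p = 0 ->
  let v := (l + k)%sph in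
  let N := (A22 u * D1 v - A12 u * D2 v)%sph in
  let M := (A11 u * D2 v - A12 u * D1 v)%sph in
  sinsq p * (D1 N p - (D1 u p + 2 * pz p) * N p + D2 M p - D2 u p * M p)
  = - (a p * D1 (detA u) p + b p * D2 (detA u) p) + 4 * pz p * a p * detA u p
    - 2 * sinsq p * detA u p * l p.
Proof.
intros H Hu Hk Ek Hp Q11 Q12.
assert (L := conformal_laplace a b l H). assert (A22a := conformal_D22a a b l H).
destruct H as [Ha Hb Hl A1 B2 B1].
assert (K1 := f_equal D1 Ek). assert (K2 := f_equal D2 Ek).
derive_in K1; derive_in K2. rewrite A1, B1 in K1; rewrite B2 in K2.
assert (K11 := f_equal D1 K1). assert (K12 := f_equal D2 K1). assert (K22 := f_equal D2 K2).
derive_in K11; rewrite ?A1 in K11; derive_in K11; rewrite ?B1, ?A1 in K11.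
derive_in K12; rewrite ?A22a, ?B2 in K12.
derive_in K22; rewrite ?A22a, ?B2 in K22.
unfold detA; cbv zeta. derive.
unfold q11, q12 in Q11, Q12. unfold fadd, fmul, fcst in Q11, Q12.
at_point Ek p; at_point K1 p; at_point K2 p; at_point K11 p; at_point K12 p; at_point K22 p. at_point L p.
sph_unfold.
rewrite D1_A11, D2_A11, D1_A12, D2_A12, D1_A22, D2_A22 by trivial.
unfold A11, A12, A22; sph_unfold.
assert (L11 : D1 (D1 l) p = pz p * D1 l p - sinsq p * l p) by lra.
assert (L12 : D2 (D1 l) p = pz p * D2 l p) by lra.
apply solve_plus in L.
apply solve0 in Ek; trivial. apply solve1 in K1, K2; trivial. apply solve2 in K11, K12, K22; trivial.
rewrite L, L12, K11, K12, K22, K1, K2, L11, Ek.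
assert (Z : pz p ^ 2 = 1 - sinsq p) by (rewrite sinsq_eq; ring).
clear - Z Hp.
generalize dependent (sinsq p). generalize (pz p).
generalize (D1 (D1 (D1 u)) p) (D2 (D1 (D1 u)) p) (D2 (D2 (D1 u)) p) (D2 (D2 (D2 u)) p).
generalize (D1 (D1 u) p) (D2 (D1 u) p) (D2 (D2 u) p) (D1 u p) (D2 u p).
generalize (D1 l p) (D2 l p) (l p) (a p) (b p) (D2 a p).
clear. intros.
field_simplify_eq; [|easy]. ring [Z].
Qed.

(** * The divergence identity *)

(** [|Hess u|^2]: the squared gradients of the ambient components of [grad u] add up to it
    plus [|grad u|^2], the contribution of the second fundamental form. *)
Definition hess2 u : S2 -> R :=
  (ginner (dx u) (dx u) + ginner (dy u) (dy u) + ginner (dz u) (dz u) - ginner u u)%sph.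

Lemma sinsq_hess2 u p : smooth u -> sinsq p <> 0 ->
  sinsq p ^ 2 * hess2 u p = (D1 (D1 u) p - pz p * D1 u p) ^ 2
   + 2 * (D2 (D1 u) p - pz p * D2 u p) ^ 2 + (D2 (D2 u) p + pz p * D1 u p) ^ 2.
Proof.
intros Hu Hp.
assert (X := sinsq_dx u Hu). assert (Y := sinsq_dy u Hu). assert (Z := dz_D1 u Hu).
assert (X1 := f_equal D1 X). assert (X2 := f_equal D2 X).
assert (Y1 := f_equal D1 Y). assert (Y2 := f_equal D2 Y).
assert (Z1 := f_equal D1 Z). assert (Z2 := f_equal D2 Z).
derive_in X1; derive_in X2; derive_in Y1; derive_in Y2; derive_in Z1; derive_in Z2.
assert (G1 := sinsq_ginner (dx u) (dx u) ltac:(smooth) ltac:(smooth)).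
assert (G2 := sinsq_ginner (dy u) (dy u) ltac:(smooth) ltac:(smooth)).
assert (G3 := sinsq_ginner (dz u) (dz u) ltac:(smooth) ltac:(smooth)).
assert (G4 := sinsq_ginner u u Hu Hu).
at_point X p; at_point Y p; at_point X1 p; at_point X2 p; at_point Y1 p; at_point Y2 p.
at_point Z1 p; at_point Z2 p.
at_point G1 p; at_point G2 p; at_point G3 p; at_point G4 p. unfold hess2; sph_unfold.
apply solve0 in X, Y, G1, G2, G3, G4; trivial. apply solve1 in X1, X2, Y1, Y2; trivial.
rewrite G1, G2, G3, G4, X1, X2, Y1, Y2, Z1, Z2, X, Y.
assert (P2 : px p ^ 2 = sinsq p - py p ^ 2) by (unfold sinsq; sph_unfold; ring).
assert (C2 : pz p ^ 2 = 1 - sinsq p) by (rewrite sinsq_eq; ring).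
field_simplify_eq; [|easy]. ring [P2 C2].
Qed.

(** [sigma_2(g^{-1} A)], expanded for [A = - Hess u + du (x) du / 2 + (1 - |du|^2 / 4) g]. *)
Definition kappa u : S2 -> R :=
  (#(1/2) * (Lap u * Lap u - hess2 u) + #1 + #(-1/16) * (ginner u u * ginner u u)
   - (#1 + #(1/4) * ginner u u) * Lap u + #(1/4) * ginner u (ginner u u))%sph.

Lemma smooth_kappa u : smooth u -> smooth (kappa u).
Proof. intros; unfold kappa, hess2; smooth. Qed.
#[export] Hint Resolve smooth_kappa : smooth.

Lemma sinsq_kappa u : smooth u -> (sinsq * sinsq * kappa u = detA u)%sph.
Proof.
intros Hu. apply smooth_eq; [smooth|unfold detA; smooth|]. intros p Hp.
assert (H2 := sinsq_hess2 u p Hu Hp).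
assert (L := sinsq_Lap u Hu). assert (G0 := sinsq_ginner u u Hu Hu).
assert (G1 := f_equal D1 G0). assert (G2 := f_equal D2 G0).
derive_in G1; derive_in G2.
assert (G3 := sinsq_ginner u (ginner u u) Hu ltac:(smooth)).
at_point L p; at_point G0 p; at_point G1 p; at_point G2 p; at_point G3 p.
apply solve0 in H2; [|now apply pow_nonzero].
apply solve0 in L, G0, G3; trivial. apply solve1 in G1, G2; trivial.
unfold kappa, detA, A11, A12, A22; sph_unfold.
rewrite H2, L, G3, G1, G2, G0.
assert (C2 : pz p ^ 2 = 1 - sinsq p) by (rewrite sinsq_eq; ring).
field_simplify_eq; [|easy]. ring [C2].
Qed.

(** [A(mer, grad v)]. *)
Definition Agrad u v : S2 -> R :=
  (#(-1) * (D1 (dx u) * dx v + D1 (dy u) * dy v + D1 (dz u) * dz v)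
   + #(1/2) * (D1 u * ginner u v) + (#1 - #(1/4) * ginner u u) * D1 v)%sph.

Lemma sinsq_Agrad u v : smooth u -> smooth v ->
  (sinsq * Agrad u v = A11 u * D1 v + A12 u * D2 v)%sph.
Proof.
intros Hu Hv. apply smooth_eq; [unfold Agrad; smooth|smooth|]. intros p Hp.
assert (X := sinsq_dx u Hu). assert (Y := sinsq_dy u Hu). assert (Z := dz_D1 u Hu).
assert (X1 := f_equal D1 X). assert (Y1 := f_equal D1 Y). assert (Z1 := f_equal D1 Z).
derive_in X1; derive_in Y1; derive_in Z1.
assert (X' := sinsq_dx v Hv). assert (Y' := sinsq_dy v Hv). assert (Z' := dz_D1 v Hv).
assert (G0 := sinsq_ginner u u Hu Hu). assert (G1 := sinsq_ginner u v Hu Hv).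
at_point X p; at_point Y p; at_point X1 p; at_point Y1 p; at_point Z1 p.
at_point X' p; at_point Y' p; at_point Z' p; at_point G0 p; at_point G1 p.
apply solve0 in X, Y, X', Y', G0, G1; trivial. apply solve1 in X1, Y1; trivial.
unfold Agrad, A11, A12; sph_unfold.
rewrite G0, G1, X1, Y1, Z1, X, Y, X', Y', Z'.
assert (P2 : px p ^ 2 = sinsq p - py p ^ 2) by (unfold sinsq; sph_unfold; ring).
assert (C2 : pz p ^ 2 = 1 - sinsq p) by (rewrite sinsq_eq; ring).
field_simplify_eq; [|easy]. ring [P2 C2].
Qed.

(** [flux1], and [flux2] divided by [sinsq], are the components of
    [T grad v + 2 sigma_2 X], multiplied by the density of [g_u] relative to the Mercator
    coordinates. The form of [flux1] is smooth at the poles; it uses [T = (tr A) g - A],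
    where [tr A = 2 - Lap u]. *)
Definition flux1 u v a : S2 -> R :=
  (fexp (#(-1) * u) * ((#2 - Lap u) * D1 v - Agrad u v + #2 * kappa u * a))%sph.
Definition flux2 u v b : S2 -> R :=
  (fexp (#(-1) * u) * (A11 u * D2 v - A12 u * D1 v + #2 * sinsq * kappa u * b))%sph.

Lemma smooth_Agrad u v : smooth u -> smooth v -> smooth (Agrad u v).
Proof. intros; unfold Agrad; smooth. Qed.
#[export] Hint Resolve smooth_Agrad : smooth.

Lemma sinsq_flux1 u v a : smooth u -> smooth v -> smooth a ->
  (sinsq * flux1 u v a =
   fexp (#(-1) * u) * (A22 u * D1 v - A12 u * D2 v + #2 * sinsq * kappa u * a))%sph.
Proof.
intros Hu Hv Ha.
assert (E := sinsq_Agrad u v Hu Hv). assert (L := sinsq_Lap u Hu).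
sph_ext p. at_point E p; at_point L p. unfold flux1; sph_unfold.
transitivity (exp (-1 * u p) * ((2 * sinsq p - sinsq p * Lap u p) * D1 v p - sinsq p * Agrad u v p
  + 2 * sinsq p * kappa u p * a p)); [ring|].
rewrite E, L. unfold A11, A12, A22; sph_unfold. field.
Qed.

Lemma exp_m2 x : exp (-2 * x) = / (exp x ^ 2).
Proof.
replace (-2 * x) with (- (x + x)) by ring. rewrite exp_Ropp, exp_plus. f_equal; ring.
Qed.

Theorem theorem1p5 (X : S2 -> R3) (u : S2 -> R)
    (HX : conformal_killing X) (Hu : smooth u) :
  sphere_int (fun p => lieD X (sigma2 u) p * exp (u p)) = 0.
Proof.
assert (H := conformal_killing_components X HX). destruct HX as [HX _].
assert (EX := fun f => sinsq_lieD X f HX).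
assert (Ha := cc_a _ _ _ H). assert (Hb := cc_b _ _ _ H). assert (Hl := cc_l _ _ _ H).
assert (Hpole : forall p, sinsq p = 0 -> mcomp X p = 0).
{ intros p Hp. apply sinsq_pole in Hp; destruct Hp as [Hx Hy].
  assert (T := vf_tangency X HX); at_point T p. assert (U := unit_coord p).
  rewrite Hx, Hy in T, U. unfold mcomp; sph_unfold.
  enough (compz X p = 0) as -> by ring.
  apply Rmult_eq_reg_l with (pz p); [lra|]. intros E; rewrite E in U; lra. }
assert (Hk : smooth (lieD X u)).
{ destruct HX as [_ [Hx [Hy Hz]]].
  replace (lieD X u) with (compx X * dx u + compy X * dy u + compz X * dz u)%sph.
  - smooth.
  - sph_ext p. symmetry; now apply dS_linear. }
revert H Ha Hb Hl Hpole EX. 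
generalize (mcomp X) (rcomp X) (divergence X); intros a b l H Ha Hb Hl Hpole EX.
set (k := lieD X u). set (v := (l + k)%sph).
assert (Hv : smooth v) by (unfold v; smooth).
apply sphere_int_divergence with (flux1 u v a) (flux2 u v b).
- unfold flux1; smooth.
- unfold flux2; smooth.
- intros p Hp. unfold flux1, Agrad; sph_unfold.
  rewrite !D1_pole, (Hpole p) by (smooth || trivial). ring.
- intros th ph Hth Hph p.
  assert (Hp : sinsq p <> 0).
  { unfold p; rewrite sinsq_sph. assert (S := sin_gt_0 th (proj1 Hth) (proj2 Hth)). nra. }
  destruct (conformal_divergence_hessian a b l th ph H Hth Hph) as [Q1 Q2].
  assert (N := newton_divergence a b l u k p H Hu Hk (EX u Hu) Hp Q1 Q2).
  cbv zeta in N. fold v in N.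
  (* [sigma2 u] is known only away from the poles, which is enough to differentiate it. *)
  assert (S : lieD X (sigma2 u) p = lieD X (kappa u * fexp (#(-2) * u))%sph p).
  { apply lieD_local; trivial. intros q Hq. rewrite sigma2_eq by trivial.
    assert (E := sinsq_kappa u Hu); at_point E q.
    assert (D : A11 u q * A22 u q - A12 u q * A12 u q = detA u q) by (unfold detA; sph_unfold; ring).
    rewrite D, <- E. sph_unfold. rewrite exp_m2. assert (Pe := exp_pos (u q)).
    field; repeat split; trivial; lra. }
  assert (E0 := EX _ (smooth_mul _ _ (smooth_kappa u Hu) (smooth_exp _ (smooth_mul _ _ (smooth_cst (-2)) Hu)))).
  assert (F1 := f_equal D1 (sinsq_flux1 u v a Hu Hv Ha)).
  assert (F0 := sinsq_flux1 u v a Hu Hv Ha).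
  assert (Hf1 : smooth (flux1 u v a)) by (unfold flux1; smooth).
  assert (K := sinsq_kappa u Hu). assert (K1 := f_equal D1 K). assert (K2 := f_equal D2 K).
  derive_in E0. derive_in F1. derive_in K1. derive_in K2.
  unfold flux2. derive.
  derive_in N.
  at_point E0 p; at_point F0 p; at_point F1 p; at_point K p; at_point K1 p; at_point K2 p.
  assert (A1 := cc_D1a _ _ _ H). assert (B2 := cc_D2b _ _ _ H).
  at_point A1 p; at_point B2 p. rewrite A1 in F1.
  unfold fadd, fmul, fcst in N. rewrite <- K, <- K1, <- K2 in N.
  rewrite S. sph_unfold. rewrite B2.
  apply solve_plus in F1.
  replace (2 * pz p * sinsq p * flux1 u v a p) with (2 * pz p * (sinsq p * flux1 u v a p)) in F1 by ring.
  rewrite F0 in F1. rewrite F1.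
  match goal with |- ?x * ?y * _ = _ =>
    replace (x * y * (sinsq p * sinsq p)) with (sinsq p * x * (y * sinsq p)) by ring end.
  rewrite E0.
  replace (exp (-1 * u p)) with (exp (-2 * u p) * exp (u p)) by (rewrite <- exp_plus; f_equal; ring).
  (* What remains is a multiple of [N], once [detA] is replaced by [sinsq^2 * kappa]. *)
  apply Rmult_eq_reg_l with (sinsq p); [|trivial].
  apply Rminus_diag_uniq. apply Rminus_diag_eq in N.
  match type of N with ?t = 0 =>
    transitivity (- (exp (-2 * u p) * exp (u p)) * t); [field|rewrite N; ring] end.
Qed.
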